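(* The following statements hold for all $k\in \mathbb{N}$ with $k\ge 3$: (1) $\mathrm{RTT}^*_2(T)=0$ for any $k$-vertex tree $T$; (2) $\mathrm{RTT}^*_{2}(F)\geq \tfrac{\gamma(F)}{k}$ for any $k$-vertex graph $F$, where $\gamma(F)$ is defined as the minimum size of a subset $S\subset V(F)$ such that $F-S$ is acyclic; (3) $\mathrm{RTT}^*_{2}(C_k)\leq \tfrac{1}{k}$ for the $k$-vertex cycle $C_k$ with $k\ge4$; (4) $\mathrm{RTT}^*_2(K_3)\geq \frac{1}{2}$.
   Context: Graphs are finite and simple; $\delta(G)$ is the minimum degree and $K_r$ the complete graph on $r$ vertices. An $F$-tiling in $G$ is a collection of vertex-disjoint copies of $F$ in $G$ (not necessarily induced); it is perfect if it covers $V(G)$. For an integer $r\ge 2$, an $r$-partite hole of size $s$ in $G$ is a collection of $r$ disjoint vertex subsets $U_1,\ldots,U_r\subset V(G)$, each of size $s$, such that there is no copy of $K_r$ in $G$ with one vertex in each $U_i$, $i\in[r]$. $\alpha^*_r(G)$ denotes the size of the largest $r$-partite hole in $G$. For a $k$-vertex graph $F$ and an integer $2\le r\le k$, $\mathrm{RTT}^*_r(F)$ denotes the largest $\eta^*_0\ge 0$ such that for all $0<\eta<\eta^*_0$ and $\alpha>0$, for all sufficiently large $n\in k\mathbb{N}$ there exists an $n$-vertex graph $G$ with $\delta(G)\ge \eta n$ and $\alpha^*_r(G)\le \alpha n$ such that $G$ does not contain a perfect $F$-tiling. *)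

(* Defs.v *)
From HB Require Import structures.
From mathcomp Require Import all_boot all_order all_algebra.
From mathcomp Require Import all_classical all_reals.
Set Implicit Arguments.
Unset Strict Implicit.
Unset Printing Implicit Defensive.
Import Order.TTheory GRing.Theory Num.Theory.

Record sgraph := SGraph {
  vertex :> finType;
  adj : rel vertex;
  adj_sym : symmetric adj;
  adj_irrefl : irreflexive adj }.
Arguments adj {G} x y : rename.

Definition complete_adj r : rel 'I_r := fun i j => i != j.

Lemma complete_adj_sym r : symmetric (@complete_adj r).
Proof. by move=> i j; rewrite /complete_adj eq_sym. Qed.

Lemma complete_adj_irrefl r : irreflexive (@complete_adj r).
Proof. by move=> i; rewrite /complete_adj eqxx. Qed.

Definition complete_graph r : sgraph :=
  SGraph (@complete_adj_sym r) (@complete_adj_irrefl r).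

(* [ordS i] is [i + 1] modulo [k]; the conjunct [i != j] only matters for
   [k = 1]. This is the k-vertex cycle when [k >= 3]. *)
Definition cycle_adj k : rel 'I_k :=
  fun i j => (i != j) && ((ordS i == j) || (ordS j == i)).

Lemma cycle_adj_sym k : symmetric (@cycle_adj k).
Proof. by move=> i j; rewrite /cycle_adj eq_sym orbC. Qed.

Lemma cycle_adj_irrefl k : irreflexive (@cycle_adj k).
Proof. by move=> i; rewrite /cycle_adj eqxx. Qed.

Definition cycle_graph k : sgraph :=
  SGraph (@cycle_adj_sym k) (@cycle_adj_irrefl k).

Section Deletion.
Variables (G : sgraph) (S : {set G}).

Definition del_adj : rel {x : G | x \notin S} :=
  fun x y => adj (val x) (val y).

Lemma del_adj_sym : symmetric del_adj.
Proof. by move=> x y; exact: adj_sym. Qed.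

Lemma del_adj_irrefl : irreflexive del_adj.
Proof. by move=> x; exact: adj_irrefl. Qed.

Definition del_vertices : sgraph := SGraph del_adj_sym del_adj_irrefl.

End Deletion.

Definition acyclic (G : sgraph) : Prop :=
  forall c : seq G, (3 <= size c)%N -> ~ ucycle adj c.

Definition connected_graph (G : sgraph) : Prop :=
  (0 < #|G|)%N /\ forall x y : G, connect adj x y.

Definition is_tree (G : sgraph) : Prop := connected_graph G /\ acyclic G.

(* The default value [#|F|] of the iterated minimum is attained at the full
   vertex set, whose deletion leaves the empty graph. *)
Definition gamma (F : sgraph) : nat :=
  \big[minn/#|F|]_(S : {set F} | `[< acyclic (del_vertices S) >]) #|S|.

Definition degree (G : sgraph) (x : G) : nat := #|[pred y | adj x y]|.

(* Every degree is smaller than [#|G|], so the default value of the iterated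
   minimum is irrelevant unless [G] is empty. *)
Definition min_degree (G : sgraph) : nat := \big[minn/#|G|]_(x : G) degree x.

(* A (not necessarily induced) copy of [F] in [G], given by an embedding. *)
Definition is_copy (F G : sgraph) (f : {ffun F -> G}) : Prop :=
  injective f /\ forall x y : F, adj x y -> adj (f x) (f y).

Definition is_tiling (F G : sgraph) (T : {set {ffun F -> G}}) : Prop :=
  (forall f, f \in T -> is_copy f) /\
  (forall f g, f \in T -> g \in T -> f != g -> [disjoint codom f & codom g]).

Definition has_perfect_tiling (F G : sgraph) : Prop :=
  exists T : {set {ffun F -> G}},
    is_tiling T /\ forall v : G, exists2 f, f \in T & v \in codom f.

(* Up to relabelling, the i-th vertex of the copy of [K_r] lies in [U i]. *)
Definition is_hole (r : nat) (G : sgraph) (s : nat) (U : 'I_r -> {set G}) :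
    Prop :=
  [/\ forall i, #|U i| = s,
      forall i j, i != j -> [disjoint U i & U j] &
      ~ exists f : {ffun complete_graph r -> G},
          is_copy f /\ forall i, f i \in U i].

Definition alpha_star (r : nat) (G : sgraph) : nat :=
  \max_(s < #|G|.+1 | `[< exists U : 'I_r -> {set G}, is_hole s U >]) s.

Local Open Scope ring_scope.

Definition RTT_lower (R : realType) (r : nat) (F : sgraph) (eta0 : R) : Prop :=
  0 <= eta0 /\
  forall eta alpha : R, 0 < eta < eta0 -> 0 < alpha ->
  exists n0 : nat, forall n : nat, (n0 <= n)%N -> (#|F| %| n)%N ->
  exists G : sgraph,
    [/\ #|G| = n,
        eta * n%:R <= (min_degree G)%:R,
        (alpha_star r G)%:R <= alpha * n%:R &
        ~ has_perfect_tiling F G].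

(* The supremum is attained, see [RTT_star_max]. *)
Definition RTT_star (R : realType) (r : nat) (F : sgraph) : R :=
  sup [set eta0 : R | RTT_lower r F eta0]%classic.

Lemma min_degree_lt (G : sgraph) : (0 < #|G|)%N -> (min_degree G < #|G|)%N.
Proof.
move=> /card_gt0P [x _]; apply: (@leq_ltn_trans (degree x)).
  rewrite /min_degree; have : x \in index_enum G by rewrite mem_index_enum.
  elim: (index_enum G) => //= y s IH; rewrite big_cons inE => /orP[/eqP<-|/IH].
    exact: geq_minl.
  exact: leq_trans (geq_minr _ _).
by apply/proper_card/properP; split; [exact/fintype.subsetP | exists x;
  rewrite // inE adj_irrefl].
Qed.

Lemma RTT_star_max (R : realType) (r : nat) (F : sgraph) : (0 < #|F|)%N ->
  RTT_lower r F (RTT_star R r F) /\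
  forall eta0 : R, RTT_lower r F eta0 -> eta0 <= RTT_star R r F.
Proof.
move=> F0; set A := [set eta0 : R | RTT_lower r F eta0]%classic.
have A0 : A 0.
  by split=> // eta al /andP[h1 h2]; have := lt_trans h1 h2; rewrite ltxx.
have ubA : ubound A 1.
  move=> e [e0 He]; rewrite leNgt; apply/negP => e1.
  have [|n0 Hn] := He 1 1 _ ltr01; first by rewrite ltr01.
  have [||G [cG dG _ _]] := Hn (#|F| * n0.+1)%N.
  - by rewrite (leq_trans (leqnSn _)) // leq_pmull.
  - exact: dvdn_mulr.
  move: dG; rewrite mul1r ler_nat -cG leqNgt min_degree_lt //.
  by rewrite cG muln_gt0 F0.
have supA : has_sup A by split; [exists 0 | exists 1].
split=> [|eta0 He]; last exact: (sup_upper_bound supA).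
split=> [|eta al /andP[e0 e1] a0]; first exact: (sup_upper_bound supA).
have [e' [_ He'] lee'] := sup_gt (ex_intro _ 0 A0 : (A !=set0)%classic) e1.
by apply: He' => //; rewrite e0.
Qed.

(* Main.v *)
(* Small bipartite holes mean that any two disjoint sets of [s = o(n)] vertices
   are joined by an edge. Hence sets of linear size contain paths through them
   in any prescribed order, and a balanced bipartite subgraph with linear minimum
   degree satisfies Hall's condition.

   Trees: a random partition of V(G) into k equal classes leaves every vertex
   with linear degree into each class; perfect matchings between the classes
   that correspond to the edges of T glue to a perfect T-tiling.

   Cycles: a vertex closes a cycle with a path on k - 1 vertices inside its
   neighbourhood. Linearly many disjoint slots of bounded size are set aside,
   each of which can be tiled after adding almost any one vertex. Minimum degree
   above n / k makes a maximum tiling of the rest leave at most as many vertices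
   as there are slots; a perfect matching distributes the leftover over the slots.

   Lower bounds: a sparse random graph, after deletions, has small holes, no
   short cycles and bounded degree. Joining fewer than (gamma / k) n vertices to
   everything gives (2). For (4), take its edges across a bipartition into two
   halves whose sizes are not divisible by 3, and make the halves almost complete
   so that no triangle crosses. *)

(* At minimum degree just above [n / k] two given vertices may have no common neighbour, so a
   leftover vertex cannot simply replace a prescribed vertex of a tile. A slot therefore has a core
   of [k - 1] vertices and boundedly many gadgets, each tiled by itself while idle; an added vertex
   activates one gadget that suits it, and core, gadget and vertex are retiled together. Gadgets
   have [3 * k] vertices and share the core, so a slot has [-1] modulo [k] vertices whichever gadget
   is active. The choice of scales is the crux: for a slot to reject only a proportion [1 / beta] of
   the vertices its size must grow like [log beta], while about [2 * n / beta] slots suffice, so for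
   large [beta] the slots together occupy a small part of the graph.

   Probabilities are replaced by counting throughout, and all estimates before the passage to [R]
   are between natural numbers; for (1) and (3) the order of the graph is taken as a convenient
   multiple of the bound on the holes. *)
Require Import Defs.
From HB Require Import structures.
From mathcomp Require Import all_boot zify boolp.
Set Implicit Arguments.
Unset Strict Implicit.
Unset Printing Implicit Defensive.

(** * Hall's theorem *)

Section Hall.
Variables (X Y : finType) (y0 : Y).

Definition nbhd_set (R : X -> Y -> bool) (S : {set X}) : {set Y} :=
  [set y | [exists x in S, R x y]].

Lemma nbhd_setP (R : X -> Y -> bool) (S : {set X}) y :
  reflect (exists2 x, x \in S & R x y) (y \in nbhd_set R S).
Proof. by rewrite inE; apply: exists_inP. Qed.

(** Induction on [#|A|]. A proper nonempty [S] with exactly [#|S|] neighbours lets [S] and [A :\: S]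
    be matched separately, the latter avoiding the neighbours of [S]. Without such [S] every
    relevant set has a spare neighbour, so any [a] may take any neighbour [b]. *)
Lemma hall (R : X -> Y -> bool) (A : {set X}) :
  (forall S : {set X}, S \subset A -> #|S| <= #|nbhd_set R S|) ->
  exists f : X -> Y, {in A &, injective f} /\ forall x, x \in A -> R x (f x).
Proof.
have [n] := ubnP #|A|; elim: n R A => // n IH R A; rewrite ltnS => leA HA.
have [->|[a aA]] := set_0Vmem A.
  by exists (fun=> y0); split=> [x ?|x]; rewrite inE.
have [/existsP[S /and4P[S0 SA nSA /eqP cS]]|] :=
  boolP [exists S : {set X}, [&& S != set0, S \subset A, S != A &
    #|nbhd_set R S| == #|S|]].
  have pS : S \proper A by rewrite finset.properEneq nSA.
  have [f [fi fR]] : exists f : X -> Y,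
      {in S &, injective f} /\ forall x, x \in S -> R x (f x).
    apply: IH => [|S' S'S]; first exact: leq_trans (proper_card pS) leA.
    exact: HA (fintype.subset_trans S'S SA).
  pose R' x y := R x y && (y \notin nbhd_set R S).
  have [g [gi gR]] : exists g : X -> Y, {in A :\: S &, injective g} /\
      forall x, x \in A :\: S -> R' x (g x).
    apply: IH => [|S' S'A].
      have := cardsID S A; rewrite (setIidPr SA); move: S0; rewrite -card_gt0.
      by move: leA; lia.
    have S'S : S' :&: S = set0.
      apply/setP=> x; rewrite !inE; apply/negbTE/negP => /andP[xS' xS].
      by have := subsetP S'A _ xS'; rewrite inE xS.
    (* Hall's condition for [S'] under [R'] is the one for [S' :|: S] minus the equality for the
       tight set [S]. *)
    have := HA (S' :|: S); rewrite subUset SA andbT.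
    rewrite (fintype.subset_trans S'A) ?subsetDl // => /(_ isT).
    rewrite cardsU S'S cards0 subn0.
    have: nbhd_set R (S' :|: S) \subset nbhd_set R' S' :|: nbhd_set R S.
      apply/subsetP=> y /nbhd_setP[x xS Rxy]; rewrite inE.
      have [|yS] := boolP (y \in nbhd_set R S); first by rewrite orbT.
      rewrite orbF; apply/nbhd_setP; exists x; last by rewrite /R' Rxy.
      move: xS; rewrite inE => /orP[//|xS]; case/negP: yS.
      by apply/nbhd_setP; exists x.
    move=> /subset_leq_card; have := cardsU (nbhd_set R' S') (nbhd_set R S).
    by move: cS; lia.
  exists (fun x => if x \in S then f x else g x); split=> [x y xA yA|x xA].
    have inN z : z \in S -> f z \in nbhd_set R S.
      by move=> zS; apply/nbhd_setP; exists z => //; apply: fR.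
    case: ifP => xS; case: ifP => yS; first exact: fi.
    - have /gR/andP[_ /negP ny] : y \in A :\: S by rewrite inE yS.
      by move=> e; case: ny; rewrite -e inN.
    - have /gR/andP[_ /negP ny] : x \in A :\: S by rewrite inE xS.
      by move=> e; case: ny; rewrite e inN.
    by apply: gi; rewrite inE ?xS ?yS.
  case: ifP => xS; first exact: fR.
  by have /gR/andP[] : x \in A :\: S by rewrite inE xS.
rewrite negb_exists => /forallP noS.
have {}noS (S : {set X}) : S != set0 -> S \subset A -> S != A ->
    #|S| < #|nbhd_set R S|.
  move=> S0 SA SnA; have := noS S; rewrite S0 SA SnA /= => ne.
  by rewrite ltn_neqAle eq_sym ne HA.
have [b Rab] : exists b, R a b.
  have := HA [set a]; rewrite sub1set aA cards1 => /(_ isT)/card_gt0P[b].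
  by case/nbhd_setP=> x; rewrite inE => /eqP-> ?; exists b.
pose R' x y := R x y && (y != b).
have [g [gi gR]] : exists g : X -> Y, {in A :\ a &, injective g} /\
    forall x, x \in A :\ a -> R' x (g x).
  apply: IH => [|S SA]; first by have := cardsD1 a A; rewrite aA; move: leA; lia.
  have [->|S0] := eqVneq S set0; first by rewrite cards0.
  have SnA : S != A.
    by apply: contraTneq SA => ->; apply/subsetPn; exists a; rewrite ?inE ?eqxx.
  have := noS S S0 (fintype.subset_trans SA (subsetDl _ _)) SnA.
  have: nbhd_set R S \subset b |: nbhd_set R' S.
    apply/subsetP=> y /nbhd_setP[x xS Rxy]; rewrite in_setU1.
    have [//|yb] := eqVneq y b.
    by apply/nbhd_setP; exists x => //; rewrite /R' Rxy.
  by move=> /subset_leq_card; rewrite cardsU1; lia.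
exists (fun x => if x == a then b else g x); split=> [x y xA yA|x xA].
  case: eqVneq => [->|xa]; case: eqVneq => [->//|ya].
  - by have /gR/andP[_ /eqP ne] : y \in A :\ a; rewrite ?inE ?ya // => /esym.
  - by have /gR/andP[_ /eqP ne] : x \in A :\ a; rewrite ?inE ?xa // => /ne.
  by apply: gi; rewrite !inE ?xa ?ya.
case: eqVneq => [->//|xa].
by have /gR/andP[] : x \in A :\ a by rewrite !inE xa.
Qed.

End Hall.

(** * Tilings *)

Lemma disjointsUr (T : finType) (A B C : {set T}) :
  [disjoint A & B :|: C] = [disjoint A & B] && [disjoint A & C].
Proof. by rewrite ![[disjoint A & _]]disjoint_sym !disjoints_subset subUset. Qed.

Lemma disjointsUl (T : finType) (A B C : {set T}) :
  [disjoint A :|: B & C] = [disjoint A & C] && [disjoint B & C].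
Proof. by rewrite !disjoints_subset subUset. Qed.

Definition joined (G : sgraph) (s : nat) : Prop :=
  forall A B : {set G}, [disjoint A & B] -> s <= #|A| -> s <= #|B| ->
  exists x y, [/\ x \in A, y \in B & adj x y].

Definition tile (F G : sgraph) (T : {set G}) : Prop :=
  exists2 f : {ffun F -> G}, is_copy f & T = [set f x | x : F].

(** Tilings are handled through the vertex sets that they cover: unions and exchanges are then
    operations on sets, and embeddings reappear only in [tileable_tiling]. *)
Inductive tileable (F G : sgraph) : {set G} -> Prop :=
| tileable0 : tileable F set0
| tileableS A T :
    tileable F A -> tile F T -> [disjoint A & T] -> tileable F (A :|: T).
Arguments tileable : clear implicits.
Arguments tileable F {G}.

Section Tileable.
Variables F G : sgraph.
Implicit Types A B T : {set G}.

Lemma card_tile T : tile F T -> #|T| = #|F|.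
Proof. by case=> f [fi _] ->; rewrite card_imset. Qed.

Lemma tileable_tile T : tile F T -> tileable F T.
Proof.
move=> tT; rewrite -[T]set0U; apply: tileableS => //; first exact: tileable0.
by rewrite disjoints_subset sub0set.
Qed.

Lemma tileableU A B :
  tileable F A -> tileable F B -> [disjoint A & B] -> tileable F (A :|: B).
Proof.
move=> tA; elim=> [|B' T tB IH tT dBT]; first by rewrite setU0.
rewrite disjointsUr => /andP[dB dT].
rewrite finset.setUA; apply: tileableS => //; first exact: IH.
by rewrite disjointsUl dBT dT.
Qed.

Lemma tileable_bigcup (I : finType) (B : I -> {set G}) (P : {set I}) :
  (forall i, i \in P -> tileable F (B i)) ->
  (forall i j, i \in P -> j \in P -> i != j -> [disjoint B i & B j]) ->
  tileable F (\bigcup_(i in P) B i).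
Proof.
have [n] := ubnP #|P|; elim: n P => // n IH P; rewrite ltnS => leP tB dB.
have [->|[a aP]] := set_0Vmem P; first by rewrite big_set0; apply: tileable0.
rewrite (big_setD1 a) //=; apply: tileableU; first exact: tB.
  apply: IH => [|i|i j].
  - by have := cardsD1 a P; rewrite aP; move: leP; lia.
  - by rewrite inE => /andP[_]; apply: tB.
  by rewrite !inE => /andP[_ iP] /andP[_ jP]; apply: dB.
apply/bigcup_disjointP => i; rewrite !inE => /andP[ia iP].
by apply: dB; rewrite // eq_sym.
Qed.

(** The last clause keeps the induction going: old tiles stay inside the old set, hence are disjoint
    from the new one. *)
Lemma tileable_tiling A : tileable F A ->
  exists T : {set {ffun F -> G}}, [/\ is_tiling T,
    forall v, v \in A -> exists2 f, f \in T & v \in codom f &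
    forall f, f \in T -> [set f x | x : F] \subset A].
Proof.
elim=> [|{}A B tA [P [[cP dP] covP subP]] [f cf ->] dAB].
  exists set0; split; first by split=> [g|g h]; rewrite inE.
    by move=> v; rewrite inE.
  by move=> g; rewrite inE.
have dfP g : g \in P -> [disjoint codom f & codom g].
  move=> gP; apply/pred0P=> v /=; apply/negP => /andP[/codomP[x ->]].
  case/codomP=> y e; have := subsetP (subP g gP) (g y) (imset_f g isT).
  by move=> /(disjointFr dAB); rewrite -e imset_f.
exists (f |: P); split; first split.
- by move=> g; rewrite in_setU1 => /orP[/eqP->|/cP].
- move=> g h; rewrite !in_setU1 => /orP[/eqP->|gP] /orP[/eqP->|hP] ne.
  + by rewrite eqxx in ne.
  + exact: dfP.
  + by rewrite disjoint_sym dfP.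
  + exact: dP.
- move=> v; rewrite inE => /orP[/covP[g gP vg]|/imsetP[x _ ->]].
    by exists g => //; rewrite in_setU1 gP orbT.
  by exists f; rewrite ?setU11 ?codom_f.
move=> g; rewrite in_setU1 => /orP[/eqP->|/subP sg]; first exact: subsetUr.
exact: fintype.subset_trans sg (subsetUl _ _).
Qed.

Lemma tileable_perfect : tileable F [set: G] -> has_perfect_tiling F G.
Proof.
by case/tileable_tiling=> T [tT covT _]; exists T; split=> // v; apply: covT; rewrite inE.
Qed.

End Tileable.

Lemma cycle_nth (T : Type) (e : rel T) (x0 : T) (s : seq T) i :
  cycle e s -> i < size s -> e (nth x0 s i) (nth x0 s (i.+1 %% size s)).
Proof.
case: s => // x s /= /(pathP x0) H; rewrite ltnS => le.
have := H i; rewrite size_rcons ltnS => /(_ le).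
rewrite nth_rcons -rcons_cons nth_rcons /= ltnS le.
move: le; rewrite leq_eqVlt => /orP[/eqP->|lt].
  by rewrite ltnn eqxx modnn.
by rewrite lt modn_small.
Qed.

Lemma tile_ucycle (k : nat) (G : sgraph) (s : seq G) :
  size s = k -> 0 < k -> uniq s -> cycle adj s ->
  tile (cycle_graph k) [set x in s].
Proof.
move=> sz k0 us cs; case: s sz us cs => [|x0 s'] sz us cs; first by rewrite -sz in k0.
set s := x0 :: s' in sz us cs *.
have lt (i : 'I_k) : i < size s by rewrite sz.
exists [ffun i : cycle_graph k => nth x0 s i].
  split=> [i j|i j]; rewrite !ffunE.
    by move=> /eqP; rewrite nth_uniq // => /eqP/val_inj.
  have H (a b : 'I_k) : ordS a == b -> adj (nth x0 s a) (nth x0 s b).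
    by move=> /eqP <-; have := cycle_nth x0 cs (lt a); rewrite sz.
  by case/andP=> _ /orP[/H //|/H]; rewrite adj_sym.
apply/setP=> v; rewrite inE; apply/idP/imsetP => [vs|[i _ ->]].
  have iv : index v s < k by rewrite -sz index_mem.
  by exists (Ordinal iv) => //; rewrite ffunE /= nth_index.
by rewrite ffunE mem_nth.
Qed.

(** Only the two ends of the path see [v], so the same path closes with any common neighbour of its
    ends. *)
Lemma tile_center (k : nat) (G : sgraph) (v x : G) (s : seq G) :
  (size s).+2 = k -> uniq [:: v, x & s] -> path adj x s -> adj v x ->
  adj v (last x s) -> tile (cycle_graph k) (v |: [set z in x :: s]).
Proof.
move=> sz us ps vx vl.
have -> : v |: [set z in x :: s] = [set z in [:: v, x & s]].
  by apply/setP=> z; rewrite !inE.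
apply: tile_ucycle => //; first by rewrite -sz.
by rewrite /= vx rcons_path ps /= adj_sym.
Qed.

(** * Paths in graphs without large bipartite holes *)

Lemma subset_of_card (T : finType) (A : {set T}) n :
  n <= #|A| -> exists2 B : {set T}, B \subset A & #|B| = n.
Proof.
move=> le; exists [set x in take n (enum A)].
  by apply/subsetP=> x; rewrite inE => /mem_take; rewrite mem_enum.
rewrite cardsE (card_uniqP _) ?take_uniq ?enum_uniq // size_take -cardE.
by case: ltngtP le => // ->.
Qed.

Definition nbrs (G : sgraph) (v : G) : {set G} := [set y | adj v y].

Section Joined.
Variables (G : sgraph) (t : nat).
Hypothesis jG : joined G t.
Implicit Types (F A B : {set G}) (As : seq {set G}).

Lemma joined_few A B :
  [disjoint A & B] -> t <= #|B| -> 0 < t ->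
  #|[set v in A | [forall w in B, ~~ adj v w]]| < t.
Proof.
move=> dAB tB t0; rewrite ltnNge; apply/negP => le.
have [|x [y [xA yB xy]]] := @jG _ B _ le tB.
  by apply: disjointWl dAB; apply/subsetP=> z; rewrite inE => /andP[].
by move: xA; rewrite inE => /andP[_ /forallP/(_ y)]; rewrite yB xy.
Qed.

Definition path_along F A As (v : G) (s : seq G) : Prop :=
  [/\ uniq (v :: s), path adj v s, size s = size As,
      forall z, z \in v :: s -> z \notin F &
      forall i, i <= size As -> nth v (v :: s) i \in nth set0 (A :: As) i].

(** The path is built from its far end, keeping [t] possible starting points. Only [2 * t] vertices
    [A1] of [A] are candidates, and they are forbidden to the rest of the path; fewer than [t] of
    them miss all the starting points of the rest. Each set thus costs [2 * t] vertices. *)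
Lemma path_along_starts F A As : 0 < t ->
  (forall B, B \in A :: As -> 2 * (size As).+1 * t <= #|B :\: F|) ->
  t <= #|[set v in A :\: F | `[< exists s, path_along F A As v s >]]|.
Proof.
move=> t0; elim: As A F => [|B As IH] A F big.
  have le : 2 * t <= #|A :\: F| by have := big A (mem_head _ _); rewrite /=; lia.
  apply: leq_trans (_ : #|A :\: F| <= _); first by move: le; lia.
  apply/subset_leq_card/subsetP=> v vA; rewrite inE vA; apply/asboolP; exists [::].
  split=> //= [z|[|//] _]; last by move: vA; rewrite inE => /andP[].
  by rewrite inE => /eqP ->; move: vA; rewrite inE => /andP[].
have [|A1 sA1 cA1] := @subset_of_card _ (A :\: F) (2 * t).
  by apply: leq_trans (big A (mem_head _ _)); rewrite leq_mul2r leq_pmulr ?orbT.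
pose R := [set v in B :\: (F :|: A1) | `[< exists s, path_along (F :|: A1) B As v s >]].
have tR : t <= #|R|.
  apply: IH => C CB; have := big C; rewrite inE CB orbT => /(_ isT) /=.
  have: #|C :\: F| <= #|C :\: (F :|: A1)| + #|A1|.
    rewrite -cardsUI; apply: leq_trans (leq_addr _ _); apply/subset_leq_card.
    by apply/subsetP=> z; rewrite !inE; do 3 case: (z \in _).
  by rewrite cA1; lia.
have dAR : [disjoint A1 & R].
  apply/pred0P=> v /=; apply/negP => /andP[vA].
  by rewrite !inE vA orbT.
have few := joined_few dAR tR t0.
set Z := [set v in A1 | _] in few.
apply: leq_trans (_ : #|A1 :\: Z| <= _).
  by have := cardsD A1 Z; rewrite cA1; have := subset_leq_card (subsetIr A1 Z); lia.
apply/subset_leq_card/subsetP=> v; rewrite in_setD => /andP[vZ vA1].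
have vAF := subsetP sA1 _ vA1; rewrite inE vAF; apply/asboolP.
move: vZ; rewrite inE vA1 negb_forall_in => /exists_inP[w wR /negPn vw].
move: (wR); rewrite inE => /andP[wB /asboolP[s [us ps ss nF ns]]].
exists (w :: s); split=> //=.
- rewrite -/(uniq (w :: s)) us andbT; apply/negP => /nF.
  by rewrite inE vA1 orbT.
- by rewrite vw.
- by rewrite ss.
- move=> z; rewrite inE => /orP[/eqP->|/nF]; last by rewrite inE negb_or => /andP[].
  by move: vAF; rewrite inE => /andP[].
- case=> [|i] /=; first by move: vAF; rewrite inE => /andP[].
  rewrite ltnS => le; have := ns i le.
  by rewrite (set_nth_default w) //= ss.
Qed.

(** Of [3 * k * t], the path needs [2 * k * t], and [F] takes at most [t <= k * t]. *)
Lemma exists_path_along k F A As :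
  size As < k -> #|F| <= t -> 0 < t ->
  (forall B, B \in A :: As -> 3 * k * t <= #|B|) ->
  exists v s, path_along F A As v s.
Proof.
move=> sz cF t0 big.
have /(leq_trans t0)/card_gt0P[v] : t <= #|[set v in A :\: F | `[< exists s, path_along F A As v s >]]|.
  apply: path_along_starts => // B /big; have := cardsD B F.
  have := subset_leq_card (subsetIr B F).
  have: 2 * (size As).+1 * t <= 2 * k * t by rewrite leq_mul // leq_mul.
  have : t <= k * t by rewrite leq_pmull //; apply: leq_ltn_trans sz.
  by move: cF; rewrite -!mulnA; lia.
by rewrite inE => /andP[_ /asboolP[s]]; exists v, s.
Qed.

End Joined.

(** Counting pairs: elements of [Y] related to less than a fraction [1 / (2 * q)] of [X] account for
    at most half of the guaranteed [#|X| * n / q] pairs. *)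
Lemma averaging (T : finType) (r : rel T) (X Y : {set T}) (n q : nat) :
  #|Y| <= n -> 0 < #|X| ->
  (forall x, x \in X -> n <= q * #|[set y in Y | r x y]|) ->
  n <= 2 * q * #|[set y in Y | #|X| <= 2 * q * #|[set x in X | r x y]| ]|.
Proof.
move=> Yn X0 deg; set Z := [set y in Y | _].
have e : \sum_(x in X) #|[set y in Y | r x y]| = \sum_(y in Y) #|[set x in X | r x y]|.
  under eq_bigr do rewrite -sum1dep_card big_mkcondr.
  under [RHS]eq_bigr do rewrite -sum1dep_card big_mkcondr.
  by rewrite exchange_big.
have lo : #|X| * n <= q * \sum_(x in X) #|[set y in Y | r x y]|.
  by rewrite big_distrr -sum_nat_const leq_sum.
have hi : 2 * q * \sum_(y in Y) #|[set x in X | r x y]| <= 2 * q * #|Z| * #|X| + n * #|X|.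
  rewrite (bigID (mem Z)) /= mulnDr leq_add //.
    rewrite -[X in _ <= X]mulnA leq_mul2l; apply/orP; right.
    apply: leq_trans (_ : \sum_(y in Y | y \in Z) #|X| <= _).
      by apply: leq_sum => y _; apply/subset_leq_card/subsetP=> z; rewrite inE => /andP[].
    rewrite !sum_nat_const leq_mul //; apply/subset_leq_card/subsetP=> z.
    by rewrite unfold_in => /andP[].
  apply: leq_trans (_ : #|Y| * #|X| <= _); last by rewrite leq_mul.
  rewrite big_distrr /= -sum_nat_const [X in _ <= X](bigID (mem Z)) /=.
  apply: leq_trans (leq_addl _ _); apply: leq_sum => y /andP[yY].
  by rewrite inE yY /= -ltnNge => /ltnW.
rewrite e in lo; rewrite -(leq_pmul2r X0).
move: lo hi; rewrite -(mulnA 2) mulnDl ?mulnA; nia.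
Qed.

(** * Absorbing gadgets for cycles *)

Definition common_in (G : sgraph) (W : {set G}) (u v : G) : {set G} :=
  [set z in W | adj u z && adj v z].

(* The shared part of all gadgets of a slot: a path [x :: s] on [k - 3] vertices
   and two hubs [h], [h']. A vertex of [B] and a hub can be exchanged: a path
   inside their common neighbourhood closes into a [k]-cycle with either one. *)
Record switch_core (G : sgraph) (k q : nat) (W : {set G}) (h h' x : G)
    (s : seq G) (B : {set G}) : Prop := SwitchCore {
  core_size : (size s).+4 = k;
  core_uniq : uniq [:: h, h', x & s];
  core_path : path adj x s;
  core_sub : {subset [:: h, h', x & s] <= W};
  core_B : B \subset W;
  core_h : forall b, b \in B -> #|G| <= 2 * q * q * #|common_in W b h|;
  core_h' : forall b, b \in B -> #|G| <= 2 * q * q * #|common_in W b h'|;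
  core_first : #|G| <= 16 * q * q * q * #|B :&: nbrs x|;
  core_last : #|G| <= 16 * q * q * q * #|B :&: nbrs (last x s)| }.

Section Switch.
Variables (G : sgraph) (k q t : nat) (W : {set G}).
Hypotheses (jG : joined G t) (t0 : 0 < t) (k4 : 3 < k).
Hypothesis degW : forall v : G, #|G| <= q * #|W :&: nbrs v|.
Hypothesis big : 48 * k * q * q * q * t <= #|G|.
Hypothesis G0 : 0 < #|G|.

Let q0 : 0 < q.
Proof.
have /card_gt0P[v _] := G0; have := degW v; case: (q) => //.
by rewrite mul0n leqNgt G0.
Qed.

Lemma setI_nbrs (X : {set G}) v : X :&: nbrs v = [set y in X | adj v y].
Proof. by apply/setP=> y; rewrite !inE. Qed.

Lemma averaging_adj (X : {set G}) : 0 < #|X| ->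
  #|G| <= 2 * q * #|[set y in W | #|X| <= 2 * q * #|X :&: nbrs y| ]|.
Proof.
move=> X0; have := @averaging _ adj X W #|G| q (max_card _) X0.
have e y : [set x in X | adj x y] = X :&: nbrs y.
  by apply/setP=> z; rewrite !inE adj_sym.
under eq_finset do rewrite e; apply=> x _.
by rewrite -setI_nbrs; apply: degW.
Qed.

Lemma common_many (h : G) :
  #|G| <= 2 * q * #|[set y in W | #|G| <= 2 * q * q * #|common_in W y h| ]|.
Proof.
have X0 : 0 < #|W :&: nbrs h|.
  by have := degW h; case: #|W :&: _| => //; rewrite muln0 leqNgt G0.
apply: leq_trans (averaging_adj X0) _; rewrite leq_mul2l; apply/orP; right.
apply/subset_leq_card/subsetP=> y; rewrite !inE => /andP[-> /=] le.
have -> : common_in W y h = W :&: nbrs h :&: nbrs y.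
  by apply/setP=> z; rewrite !inE; case: (adj y z); rewrite ?andbF ?andbT.
by apply: leq_trans (degW h) _; have := leq_mul (leqnn q) le; lia.
Qed.

(** The hub [h] is arbitrary; averaging the relation of having many common neighbours over [Bh h]
    gives [h'] such that [B], the vertices good for both hubs, has at least [#|G| / (8 * q ^ 2)]
    elements. A further averaging over [B] gives the set [A] of vertices with many neighbours in
    [B], and the path runs inside [A] so that both its ends have this property. *)
Lemma exists_core : 2 <= t -> 4 * q < #|G| ->
  exists h h' x s B, switch_core k q W h h' x s B.
Proof.
move=> t2 q4.
have /card_gt0P[h hW] : 0 < #|W|.
  rewrite lt0n; apply: contraTneq G0 => W0; have /card_gt0P[v _] := G0.
  have := degW v; have := subset_leq_card (subsetIl W (nbrs v)).
  by rewrite W0 leqn0 => /eqP ->; rewrite muln0 -leqNgt.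
pose Bh h := [set y in W | #|G| <= 2 * q * q * #|common_in W y h| ].
have cB h1 : #|G| <= 2 * q * #|Bh h1| by apply: common_many.
have Bpos : 0 < #|Bh h|.
  by have := cB h; case: #|Bh h| => //; rewrite muln0 leqNgt G0.
have symc y z : (#|G| <= 2 * q * q * #|common_in W y z|) =
    (#|G| <= 2 * q * q * #|common_in W z y|).
  by congr (_ <= _ * #|(_ : {set _})|); apply/setP=> w; rewrite !inE [_ && adj z _]andbC.
have [h' h'W [hh' cBB]] : exists2 h', h' \in W & h != h' /\
    #|Bh h| <= 4 * q * #|Bh h :&: Bh h'|.
  have := @averaging _ (fun y z => #|G| <= 2 * q * q * #|common_in W y z|)
     (Bh h) W #|G| (2 * q) (max_card _) Bpos.
  have -> : 2 * (2 * q) = 4 * q by lia.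
  move=> av.
  have {av} : #|G| <= 4 * q *
      #|[set y in W | #|Bh h| <= 4 * q * #|Bh h :&: Bh y| ]|.
    apply: leq_trans (av _) _.
      move=> y _; apply: leq_trans (cB y) _; rewrite leq_mul2l; apply/orP; right.
      by apply/subset_leq_card/subsetP=> z; rewrite !inE symc.
    rewrite leq_mul2l; apply/orP; right; apply/subset_leq_card/subsetP=> z.
    rewrite !inE => /andP[-> /= le]; apply: leq_trans le _.
    rewrite leq_mul2l; apply/orP; right.
    by apply/subset_leq_card/subsetP=> w; rewrite !inE => /andP[/andP[-> ->] ->].
  (* [4 * q < #|G|] gives [Z] at least two elements, hence one other than [h]. *)
  set Z := [set y in W | _] => cZ.
  have /card_gt0P[h'] : 0 < #|Z :\ h|.
    have := cardsD1 h Z; case: (h \in Z) => //=; last by move: cZ q4; nia.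
    by move: cZ q4; nia.
  by rewrite !inE => /and3P[ne h'W le]; exists h' => //; rewrite eq_sym.
pose B := Bh h :&: Bh h'.
have cB' : #|G| <= 8 * q * q * #|B| by have := cB h; move: cBB; rewrite -/B; nia.
have B0 : 0 < #|B|.
  by move: cB'; case: #|B| => //; rewrite muln0 leqNgt G0.
pose A := [set y in W | #|B| <= 2 * q * #|B :&: nbrs y| ].
have cA : #|G| <= 2 * q * #|A| := averaging_adj B0.
have Aok y : y \in A -> #|G| <= 16 * q * q * q * #|B :&: nbrs y|.
  by rewrite inE => /andP[_ le]; move: cB'; nia.
have [||||x [s [us ps ss nF ns]]] :=
    @exists_path_along _ _ jG k [set h; h'] A (nseq (k - 4) A).
- by rewrite size_nseq; lia.
- by apply: leq_trans t2; rewrite cards2; case: (_ != _).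
- exact: t0.
- move=> C; rewrite inE mem_nseq => CA.
  have -> : C = A by case/orP: CA => [/eqP//|/andP[_ /eqP]].
  have h1 : 0 < q * q by rewrite muln_gt0 q0.
  have h2 : 24 * k * q * q * t <= #|A|.
    rewrite -(leq_pmul2l (_ : 0 < 2 * q)) ?muln_gt0 ?q0 //.
    by apply: leq_trans cA; apply: leq_trans big; nia.
  by apply: leq_trans h2; nia.
rewrite size_nseq in ss.
have sA y : y \in x :: s -> y \in A.
  move=> ys; have := ns (index y (x :: s)); rewrite -[_ <= _]ltnS size_nseq.
  have -> : (k - 4).+1 = size (x :: s) by rewrite /= ss.
  rewrite index_mem nth_index // => /(_ ys).
  by case: index => [|i] //=; rewrite nth_nseq; case: ifP => //; rewrite inE.
have AW y : y \in A -> y \in W by rewrite inE => /andP[].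
exists h, h', x, s, B; split=> //.
- by rewrite ss; lia.
- rewrite cons_uniq inE negb_or hh' /= -/(uniq (x :: s)) us andbT.
  by apply/andP; split; apply/negP => /nF; rewrite !inE eqxx ?orbT.
- move=> y; rewrite inE => /orP[/eqP->//|]; rewrite inE => /orP[/eqP->//|/sA].
  exact: AW.
- by apply/subsetP=> y; rewrite !inE => /andP[/andP[]].
- by move=> b; rewrite !inE => /andP[/andP[]].
- by move=> b; rewrite !inE => /andP[_ /andP[]].
- by apply/Aok/sA/mem_head.
- by apply/Aok/sA/mem_last.
Qed.

End Switch.

Lemma set_seq_cat (T : finType) (l1 l2 : seq T) :
  [set z in l1 ++ l2] = [set z in l1] :|: [set z in l2].
Proof. by apply/setP=> z; rewrite !inE mem_cat. Qed.

Lemma tileable_cat (F G : sgraph) (l1 l2 : seq G) : uniq (l1 ++ l2) ->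
  tileable F [set z in l1] -> tileable F [set z in l2] ->
  tileable F [set z in l1 ++ l2].
Proof.
rewrite cat_uniq => /and3P[_ /hasPn nh _] t1 t2; rewrite set_seq_cat.
apply: tileableU => //; apply/pred0P=> z /=; rewrite !inE.
by apply/negP => /andP[z1 /nh]; rewrite z1.
Qed.

Lemma tileable_perm (F G : sgraph) (l1 l2 : seq G) : perm_eq l1 l2 ->
  tileable F [set z in l1] -> tileable F [set z in l2].
Proof.
move=> /perm_mem e; suff -> : [set z in l1] = [set z in l2] by [].
by apply/setP=> z; rewrite !inE e.
Qed.

(** Used inside a common neighbourhood of two vertices: either of them then closes the same path,
    which makes them interchangeable. *)
Lemma exists_star_path (G : sgraph) (k t : nat) (F A : {set G}) :
  joined G t -> 0 < t -> 2 < k -> #|F| <= t -> 3 * k * t <= #|A| ->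
  exists T : seq G, [/\ size T = k.-1, uniq T,
    forall z, z \in T -> (z \in A) && (z \notin F) &
    forall v, v \notin T -> {subset T <= nbrs v} ->
      tile (cycle_graph k) [set z in v :: T]].
Proof.
move=> jG t0 k3 cF cA.
have [|||B|x [s [us ps ss nF ns]]] :=
  @exists_path_along G t jG k F A (nseq (k - 2) A) => //.
  by rewrite size_nseq; lia.
  rewrite inE mem_nseq => CA.
  by have -> : B = A by case/orP: CA => [/eqP//|/andP[_ /eqP]].
rewrite size_nseq in ss.
have sA y : y \in x :: s -> y \in A.
  move=> ys; have := ns (index y (x :: s)); rewrite -[_ <= _]ltnS size_nseq.
  have -> : (k - 2).+1 = size (x :: s) by rewrite /= ss.
  rewrite index_mem nth_index // => /(_ ys).
  by case: index => [|i] //=; rewrite nth_nseq; case: ifP => //; rewrite inE.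
exists (x :: s); split=> //.
- by rewrite /= ss; lia.
- by move=> z zs; rewrite sA ?nF.
move=> v vT sub.
have -> : [set z in [:: v, x & s]] = v |: [set z in x :: s].
  by apply/setP=> z; rewrite !inE.
apply: tile_center => //.
- by rewrite ss; lia.
- by rewrite cons_uniq vT.
- by have := sub x (mem_head _ _); rewrite inE.
- by have := sub _ (mem_last x s); rewrite inE.
Qed.

Section Slot.
Variables (G : sgraph) (k q t : nat) (W : {set G}).
Hypotheses (jG : joined G t) (t0 : 0 < t) (k4 : 3 < k).
Hypothesis degW : forall v : G, #|G| <= q * #|W :&: nbrs v|.
Hypothesis big : 48 * k * q * q * q * t <= #|G|.
Hypothesis G0 : 0 < #|G|.

Let q0 : 0 < q.
Proof.
have /card_gt0P[v _] := G0; have := degW v; case: (q) => //.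
by rewrite mul0n leqNgt G0.
Qed.

Local Notation tC := (tileable (cycle_graph k)).

(** Two averagings, each costing a factor [2 * q]: first an end [y] that sees a large part [X1] of
    [X], then a set [D] of vertices that see a large part of this [X1]. A path from [y] through its
    neighbourhood and [k - 4] free vertices into [D] has [k - 1] vertices, and every common
    neighbour of its ends closes it. *)
Lemma exists_cover_path (F X : {set G}) : #|F| < t -> X \subset W ->
  12 * k * q * q * t <= #|X| ->
  exists (p : seq G) (X1 : {set G}), [/\ size p = k.-1, uniq p,
    forall z, z \in p -> (z \in W) && (z \notin F),
    X1 \subset X /\ #|X| <= 4 * q * q * #|X1| &
    forall y, y \in X1 -> y \notin p -> tC [set z in y :: p]].
Proof.
move=> cF XW cX.
have kE : (k - 4).+4 = k by clear -k4; lia.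
have X0 : 0 < #|X|.
  by apply: leq_trans cX; rewrite !muln_gt0 q0 t0; lia.
have bG : 48 * (k * t * q) <= #|G|.
  apply: leq_trans big; rewrite -!(mulnA 48) leq_mul2l /=.
  have : 0 < q * q by rewrite muln_gt0 q0.
  by move=> /(leq_pmulr (k * t * q)) /leq_trans; apply; lia.
have kt : t <= k * t by rewrite leq_pmull; lia.
have ktq : k * t <= k * t * q by rewrite leq_pmulr.
have avX := averaging_adj degW X0.
have [y yZ yF] : exists2 y, y \in [set y in W | #|X| <= 2 * q * #|X :&: nbrs y| ] & y \notin F.
  apply/exists_inP; apply: contraTT avX; rewrite negb_exists_in => /forall_inP ZF.
  rewrite -ltnNge; have : #|[set y in W | #|X| <= 2 * q * #|X :&: nbrs y| ]| <= #|F|.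
    by apply/subset_leq_card/subsetP=> z /ZF /negPn.
  move=> le; apply: leq_trans bG.
  apply: leq_ltn_trans (leq_mul (leqnn _) (leq_trans le (ltnW cF))) _.
  have : q * t <= q * (k * t) by rewrite leq_mul2l kt orbT.
  by have : 0 < q * t; [rewrite muln_gt0 q0 | lia].
move: yZ; rewrite inE => /andP[yW cXy].
pose X1 := X :&: nbrs y.
have X10 : 0 < #|X1|.
  by move: cXy; rewrite -/X1; case: #|X1| => //; rewrite muln0 leqNgt X0.
pose D := [set y in W | #|X1| <= 2 * q * #|X1 :&: nbrs y| ].
have cD : #|G| <= 2 * q * #|D| := averaging_adj degW X10.
have [||||v [r [ur pr sr nF nr]]] :=
  @exists_path_along G t jG k (y |: F) (W :&: nbrs y) (rcons (nseq (k - 4) W) D).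
- by rewrite size_rcons size_nseq; lia.
- by rewrite cardsU1; case: (_ \notin _) => //=; lia.
- by [].
- have c1 : 3 * k * t <= #|D|.
    rewrite -(leq_pmul2l (_ : 0 < 2 * q)) ?muln_gt0 //.
    by apply: leq_trans cD; apply: leq_trans bG; lia.
  have c2 : 3 * k * t <= #|W :&: nbrs y|.
    rewrite -(leq_pmul2l q0).
    by apply: leq_trans (degW y); apply: leq_trans bG; lia.
  have c3 : 3 * k * t <= #|W|.
    by apply: leq_trans c2 _; apply: subset_leq_card; apply: subsetIl.
  move=> C; rewrite inE mem_rcons inE mem_nseq => /or3P[/eqP->|/eqP->|/andP[_ /eqP->]] //.
rewrite size_rcons size_nseq in sr nr.
have vN : adj y v by have := nr 0 isT; rewrite /= !inE => /andP[].
have vW : v \in W by have := nr 0 isT; rewrite /= !inE => /andP[].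
have lD : last v r \in D.
  have := nr (k - 4).+1 (leqnn _); rewrite /= nth_rcons size_nseq ltnn eqxx.
  by rewrite (last_nth v) sr.
have rW z : z \in r -> z \in W.
  move=> zr; have zi : index z r < size r by rewrite index_mem.
  have := nr (index z r).+1; rewrite ltnS /= nth_index // nth_rcons size_nseq.
  rewrite sr ltnS in zi; rewrite zi => /(_ isT).
  case: ltnP => lt; first by rewrite nth_nseq lt.
  have -> : index z r = k - 4 by apply/eqP; rewrite eqn_leq lt zi.
  by rewrite eqxx inE => /andP[].
have us : uniq [:: y, v & r].
  rewrite cons_uniq ur andbT; apply/negP => /nF; by rewrite setU11.
exists [:: y, v & r], (X1 :&: nbrs (last v r)); split=> //.
- by rewrite /= sr -[in RHS]kE.
- move=> z; rewrite inE => /orP[/eqP->|zr]; first by rewrite yW.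
  have := nF z zr; rewrite in_setU1 negb_or => /andP[_ ->]; rewrite andbT.
  by move: zr; rewrite inE => /orP[/eqP->|/rW].
- split; first by rewrite -finset.setIA subsetIl.
  move: lD; rewrite inE => /andP[_ l2]; apply: leq_trans cXy _.
  by have := leq_mul (leqnn (2 * q)) l2; rewrite -/X1; clear; lia.
move=> z; rewrite !inE => /andP[/andP[_ yz] lz] zp.
have -> : [set w in [:: z, y, v & r]] = z |: [set w in [:: y, v & r]].
  by apply/setP=> w; rewrite !inE.
apply/tileable_tile/tile_center; rewrite //=.
- by rewrite sr.
- by rewrite -/(uniq [:: z, y, v & r]) cons_uniq us andbT !inE.
- by rewrite vN.
- by rewrite adj_sym.
- by rewrite adj_sym.
Qed.

End Slot.

(** For rearrangements of the same pieces, [permP] leaves an identity that is linear in the counts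
    of the pieces. *)
Ltac perm_count :=
  let a := fresh "a" in
  apply/permP => a; rewrite -?cats1; do 4 rewrite /= ?count_cat; clear; lia.

Section Gadget.
Variables (G : sgraph) (k q t : nat) (W : {set G}).
Hypotheses (jG : joined G t) (t0 : 0 < t) (k4 : 3 < k).
Hypothesis degW : forall v : G, #|G| <= q * #|W :&: nbrs v|.
Hypothesis big : 48 * k * q * q * q * t <= #|G|.
Hypothesis G0 : 0 < #|G|.

Let q0 : 0 < q.
Proof.
have /card_gt0P[v _] := G0; have := degW v; case: (q) => //.
by rewrite mul0n leqNgt G0.
Qed.

Local Notation tC := (tileable (cycle_graph k)).

(* The gadget [l] consists of paths [p], [S], [S'] on [k - 1] vertices and of
   vertices [b], [c], [b']. Without [y] it splits into [c :: p], [b :: S],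
   [b' :: S']. If [y] is adjacent to both ends of [p], then [y] takes the place
   of [c], and [c] goes to the cycle through [b], [x :: s], [b'], which frees
   [S] and [S'] for the hubs [h] and [h']. *)
Lemma exists_gadget (h h' x : G) (s : seq G) (B F X : {set G}) :
  switch_core k q W h h' x s B -> {subset [:: h, h', x & s] <= F} ->
  #|F| + 4 * k < t -> X \subset W -> 12 * k * q * q * t <= #|X| ->
  exists (l : seq G) (X1 : {set G}), [/\ size l = 3 * k, uniq l,
    forall z, z \in l -> (z \in W) && (z \notin F),
    X1 \subset X /\ #|X| <= 4 * q * q * #|X1| &
    tC [set z in l] /\
    forall y, y \in X1 -> y \notin F -> y \notin l ->
      tC [set z in y :: [:: h, h', x & s] ++ l]].
Proof.
move=> [sk us ps sW BW Bh Bh' B1 B2] sF cF XW cX.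
have cF0 : #|F| < t by apply: leq_ltn_trans cF; rewrite leq_addr.
have [p [X1 [sp up pW [X1X cX1] tp]]] := exists_cover_path jG t0 k4 degW big G0 cF0 XW cX.
have bigX1 : 3 * k * t <= #|X1|.
  have q4 : 0 < 4 * q * q by rewrite !muln_gt0 q0.
  by rewrite -(leq_pmul2l q4); apply: leq_trans cX1; apply: leq_trans cX; clear; lia.
have big1 (A : {set G}) : #|G| <= 16 * q * q * q * #|A| -> 3 * k * t <= #|A|.
  move=> le; rewrite -(leq_pmul2l (_ : 0 < 16 * q * q * q)) ?muln_gt0 ?q0 //.
  by apply: leq_trans le; apply: leq_trans big; clear; lia.
have big2 (A : {set G}) : #|G| <= 2 * q * q * #|A| -> 3 * k * t <= #|A|.
  move=> le; apply: big1; apply: leq_trans le _.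
  by have := leq_pmull (q * q * #|A|) q0; clear; lia.
have cU (A : {set G}) l : #|A :|: [set z in l]| <= #|A| + size l.
  by apply: leq_trans (leq_card_setU _ _) _; rewrite leq_add2l cardsE card_size.
(* The path [b], [c], [b'] has [c] in [X1], so that [p] closes with [c] as well as with any other
   vertex of [X1]; [b] and [b'] continue to the two ends of the core path. *)
have [|||C|b [m [um pm sm nFm nm]]] :=
  @exists_path_along G t jG k (F :|: [set z in p]) (B :&: nbrs x) [:: X1; B :&: nbrs (last x s)].
- by rewrite /=; clear -k4; lia.
- by apply: leq_trans (cU _ _) _; rewrite sp; clear -cF; lia.
- by [].
- by rewrite !inE => /or3P[/eqP->|/eqP->|/eqP->] //; apply: big1.
case: m um pm sm nFm nm => [|c [|b' [|]]] // um pm sm nFm nm.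
have := nm 0 isT; rewrite /= !inE => /andP[bB xb].
have /= cX1' := nm 1 isT.
have := nm 2 isT; rewrite /= !inE => /andP[b'B lb'].
have [bc cb'] : adj b c /\ adj c b' by move: pm => /= /and3P[].
pose F3 := F :|: [set z in p ++ [:: b; c; b']].
have cF3 : #|F3| + (k + k) <= t.
  apply: leq_trans (_ : #|F| + size (p ++ [:: b; c; b']) + (k + k) <= _).
    by rewrite leq_add2r cU.
  by rewrite size_cat sp /=; clear -cF k4; lia.
have [|||S [sS uS SA tS]] := @exists_star_path G k t F3 (common_in W b h) jG t0.
- by clear -k4; lia.
- by clear -cF3; lia.
- exact/big2/Bh.
have [|||S' [sS' uS' SA' tS']] :=
    @exists_star_path G k t (F3 :|: [set z in S]) (common_in W b' h') jG t0.
- by clear -k4; lia.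
- by apply: leq_trans (cU _ _) _; rewrite sS; clear -cF3 k4; lia.
- exact/big2/Bh'.
pose l := p ++ [:: b; c; b'] ++ S ++ S'.
have SW z : z \in S -> z \in W by move=> /SA; rewrite !inE => /andP[/andP[]].
have SW' z : z \in S' -> z \in W by move=> /SA'; rewrite !inE => /andP[/andP[]].
have X1W := subsetP (fintype.subset_trans X1X XW).
have lF z : z \in l -> (z \in W) && (z \notin F).
  rewrite /l !mem_cat => /or4P[/pW //|zm|zS|zS].
  - have zW : z \in W.
      move: zm; rewrite !inE => /or3P[] /eqP->; [exact: (subsetP BW) | exact: X1W | exact: (subsetP BW)].
    by rewrite zW; have := nFm z zm; rewrite inE negb_or => /andP[].
  - by rewrite SW //; have /andP[_] := SA z zS; rewrite inE negb_or => /andP[].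
  - rewrite SW' //; have /andP[_] := SA' z zS.
    by rewrite !inE !negb_or => /andP[/andP[]].
have ul : uniq l.
  have d1 : uniq (p ++ [:: b; c; b']).
    rewrite cat_uniq up um andbT; apply/hasPn => z /nFm.
    by rewrite !inE negb_or => /andP[].
  have d2 : uniq ((p ++ [:: b; c; b']) ++ S).
    rewrite cat_uniq d1 uS andbT; apply/hasPn => z /SA/andP[_].
    by rewrite !inE negb_or => /andP[].
  rewrite /l !catA cat_uniq d2 uS' andbT; apply/hasPn => z /SA'/andP[_].
  by rewrite !inE !mem_cat !inE !negb_or -!andbA => /and5P[_ -> -> -> /andP[-> ->]].
exists l, X1; split=> //.
  by rewrite /l !size_cat sp sS sS' /=; clear -k4; lia.
have nS z : z \in S -> z \notin p ++ [:: b; c; b'].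
  by move=> /SA/andP[_]; rewrite !inE negb_or => /andP[].
have nS' z : z \in S' -> z \notin p ++ [:: b; c; b'].
  by move=> /SA'/andP[_]; rewrite !inE !negb_or => /andP[/andP[]].
have sbS : {subset S <= nbrs b} by move=> z /SA; rewrite !inE => /andP[/and3P[]].
have shS : {subset S <= nbrs h} by move=> z /SA; rewrite !inE => /andP[/and3P[]].
have sbS' : {subset S' <= nbrs b'} by move=> z /SA'; rewrite !inE => /andP[/and3P[]].
have shS' : {subset S' <= nbrs h'} by move=> z /SA'; rewrite !inE => /andP[/and3P[]].
have nFl z : z \in F -> z \notin l by apply: contraL => /lF/andP[].
split=> [|y yX1 yF yl].
  have pe : perm_eq ((c :: p) ++ (b :: S) ++ (b' :: S')) l by rewrite /l; perm_count.
  apply: (tileable_perm pe).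
  have := ul; rewrite -(perm_uniq pe) => u1.
  have := u1; rewrite cat_uniq => /and3P[_ _ u2].
  apply: (tileable_cat u1).
    apply: tp => //; have := um; rewrite /= !inE.
    by have := nFm c; rewrite !inE eqxx orbT negb_or => /(_ isT)/andP[].
  apply: (tileable_cat u2); apply: tileable_tile.
    apply: tS => //; apply: contraL (ul) => /nS; by rewrite mem_cat !inE eqxx !orbT.
  apply: tS' => //; apply: contraL (ul) => /nS'; by rewrite mem_cat !inE eqxx !orbT.
have pe : perm_eq ((y :: p) ++ (c :: b :: x :: rcons s b') ++ (h :: S) ++ (h' :: S'))
   (y :: [:: h, h', x & s] ++ l) by rewrite /l; perm_count.
have u0 : uniq (y :: [:: h, h', x & s] ++ l).
  rewrite cons_uniq mem_cat negb_or yl cat_uniq us ul !andbT.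
  apply/andP; split; first by apply: contra yF => /sF.
  by apply/hasPn => z /lF/andP[_]; apply: contra => /sF.
apply: (tileable_perm pe); move: u0; rewrite -(perm_uniq pe) => u1.
have := u1; rewrite cat_uniq => /and3P[_ _ u2].
have := u2; rewrite cat_uniq => /and3P[uc _ u3].
apply: (tileable_cat u1).
  by apply: tp => //; apply: contra yl; rewrite /l mem_cat => ->.
apply: (tileable_cat u2).
  apply/tileable_tile/tile_ucycle => //.
  - by rewrite /= size_rcons; exact: sk.
  - by clear -k4; lia.
  by rewrite /= adj_sym bc adj_sym xb !rcons_path last_rcons ps lb' adj_sym cb'.
apply: (tileable_cat u3); apply: tileable_tile.
  apply: tS => //; apply: contra (nFl h (sF h _)); rewrite ?inE ?eqxx //.
  by rewrite /l !mem_cat => ->; rewrite !orbT.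
apply: tS' => //; apply: contra (nFl h' (sF h' _)); rewrite ?inE ?eqxx ?orbT //.
by rewrite /l !mem_cat => ->; rewrite !orbT.
Qed.

End Gadget.

Lemma dvdn_tileable (F G : sgraph) (A : {set G}) :
  tileable F A -> #|F| %| #|A|.
Proof.
elim=> [|B T _ dB tT]; first by rewrite cards0 dvdn0.
by rewrite -leq_card_setU => /eqP ->; rewrite (card_tile tT) dvdn_addl.
Qed.

(* Each new gadget covers a [1 / (4 q ^ 2)] fraction of the vertices not yet
   covered, hence boundedly many gadgets on one core absorb almost every vertex. *)
Lemma exists_slot (G : sgraph) (k q t : nat) (W : {set G}) (beta Q : nat) :
  joined G t -> 3 < k ->
  (forall v : G, #|G| <= q * #|W :&: nbrs v|) ->
  0 < #|G| -> 4 * q < #|G| -> 48 * k * q * q * q * t <= #|G| ->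
  12 * k * q * q * t * beta <= #|G| ->
  (4 * q * q).-1 ^ Q * beta <= (4 * q * q) ^ Q ->
  3 * k * Q + 5 * k < t ->
  exists (S : seq G) (X : {set G}),
    [/\ uniq S, {subset S <= W}, k %| (size S).+1 /\ size S <= 3 * k * Q + k,
      beta * #|X| <= #|G| &
      forall y, y \in W -> y \notin S -> y \notin X ->
        tileable (cycle_graph k) [set z in y :: S]].
Proof.
move=> jG k4 degW G0 G4q big bigb betaQ tbig.
have t2 : 1 < t by apply: leq_trans tbig; clear -k4; lia.
have t0 : 0 < t by apply: ltnW.
have q0 : 0 < q.
  have /card_gt0P[v _] := G0; have := degW v; case: (q) => //.
  by rewrite mul0n leqNgt G0.
have [h [h' [x [s [B core]]]]] := exists_core jG t0 k4 degW big G0 t2 G4q.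
pose co := [:: h, h', x & s].
have sco : size co < k by rewrite -(core_size core).
(* [R] collects the gadgets and [X] the vertices that none of them absorbs, initially all of [W].
   The first disjunct records that [X] may get too small for another gadget, after which nothing
   more is added. *)
have [] : exists (R : seq G) (X : {set G}), [/\ uniq (co ++ R) /\ size R <= 3 * k * Q,
    {subset R <= W}, X \subset W /\ tileable (cycle_graph k) [set z in R],
    beta * #|X| <= #|G| \/ #|X| * (4 * q * q) ^ Q <= (4 * q * q).-1 ^ Q * #|G| &
    forall y, y \in W -> y \notin co ++ R -> y \notin X ->
        tileable (cycle_graph k) [set z in y :: co ++ R]].
  have : 3 * k * Q + 5 * k < t by [].
  elim: {betaQ tbig}Q => [|i IH] tbig.
    exists [::], W; split=> //.
    - by rewrite cats0; split=> //; exact: core_uniq core.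
    - split=> //; suff -> : [set z in [::]] = set0 :> {set G} by exact: tileable0.
      by apply/setP=> z; rewrite !inE.
    - by right; rewrite !expn0 muln1 mul1n max_card.
    by move=> y yW _; rewrite yW.
  have [|R [X [[uR sR] RW [XW tR] cX tX]]] := IH.
    by apply: leq_ltn_trans tbig; rewrite leq_add2r leq_mul2l leqnSn orbT.
  have sR' : size R <= 3 * k * i.+1 by apply: leq_trans sR _; rewrite leq_mul2l leqnSn orbT.
  have [small|large] := leqP (beta * #|X|) #|G|.
    by exists R, X; split=> //; left.
  case: cX => [cX|cX]; first by move: large; rewrite ltnNge cX.
  have [||||l [X1 [sl ul lW [X1X cX1] [tl tX1]]]] :=
      @exists_gadget G k q t W jG t0 k4 degW big G0 h h' x s B [set z in co ++ R] X core.
  - by move=> z zc; rewrite inE mem_cat zc.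
  - apply: leq_ltn_trans (_ : size (co ++ R) + 4 * k < t).
      by rewrite leq_add2r cardsE card_size.
    apply: leq_trans tbig; rewrite size_cat ltnS.
    by move: sR sco; rewrite mulnS; clear; lia.
  - exact: XW.
  - rewrite leqNgt; apply/negP => lt; move: large; rewrite ltnNge => /negP; apply.
    by apply: leq_trans bigb; rewrite mulnC leq_mul2r ltnW ?orbT.
  have ull : uniq (co ++ l ++ R).
    move: uR; rewrite !cat_uniq => /and3P[-> nR ->]; rewrite ul !andbT /=.
    apply/andP; split; apply/hasPn => z.
      rewrite mem_cat => /orP[/lW/andP[_]|zR]; last by move/hasPn: nR; apply.
      by rewrite inE mem_cat negb_or => /andP[].
    move=> zR; apply/negP => /lW/andP[_].
    by rewrite inE mem_cat zR orbT.
  exists (l ++ R), (X :\: X1); split.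
  - split=> //; rewrite size_cat sl.
    by apply: leq_trans (_ : 3 * k + 3 * k * i <= _); rewrite ?leq_add2l // mulnS.
  - by move=> z; rewrite mem_cat => /orP[/lW/andP[]|/RW].
  - split; first by apply: fintype.subset_trans XW; apply: subsetDl.
    by apply: tileable_cat => //; move: ull; rewrite cat_uniq => /and3P[].
  - right; have := cardsD X X1; rewrite (setIidPr X1X) => ->.
    have cX2 := subset_leq_card X1X; rewrite !expnS.
    have Xq : (#|X| - #|X1|) * (4 * q * q) <= (4 * q * q).-1 * #|X|.
      by rewrite mulnBl -subn1 mulnBl mul1n [X in _ <= X - _]mulnC leq_sub2l // mulnC.
    move: cX Xq; set c := 4 * q * q => cX Xq.
    rewrite mulnA; apply: leq_trans (leq_mul Xq (leqnn _)) _.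
    by rewrite -!mulnA leq_mul2l cX orbT.
  move=> y yW ny; rewrite inE negb_and negbK => yX.
  have pe : perm_eq ((y :: co ++ R) ++ l) (y :: co ++ l ++ R) by perm_count.
  have u1 : uniq (y :: co ++ l ++ R) by rewrite cons_uniq ny.
  (* Exactly one gadget is active: for [y] in [X1] it is the new [l] while [R] keeps its own tiling,
     otherwise [l] is tiled by itself and [y] is left to the older ones. *)
  have [yX1|nyX1] := boolP (y \in X1).
    have pe' : perm_eq ((y :: co ++ l) ++ R) (y :: co ++ l ++ R) by perm_count.
    apply: (tileable_perm pe'); apply: tileable_cat => //.
      by rewrite (perm_uniq pe').
    apply: tX1 => //.
      by move: ny; rewrite inE !mem_cat !negb_or => /and3P[-> _ ->].
    by move: ny; rewrite !mem_cat !negb_or => /and3P[].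
  apply: (tileable_perm pe); apply: tileable_cat => //.
    by rewrite (perm_uniq pe).
  apply: tX => //; last by move: yX; rewrite (negPf nyX1).
  by move: ny; rewrite !mem_cat !negb_or => /and3P[-> _ ->].
move=> R [X [[uR sR] RW [XW tR] cX tX]].
exists (co ++ R), X; split=> //.
- by move=> z; rewrite mem_cat => /orP[/(core_sub core)|/RW].
- split; last by rewrite size_cat addnC leq_add // ltnW.
  have szk : (size co).+1 = k := core_size core.
  rewrite size_cat -addSn szk dvdn_addr //.
  have := dvdn_tileable tR; rewrite card_ord cardsE (card_uniqP _) //.
  by move: uR; rewrite cat_uniq => /and3P[].
case: cX => // cX; rewrite -(leq_pmul2r (_ : 0 < (4 * q * q) ^ Q)).
  rewrite -mulnA; apply: leq_trans (leq_mul (leqnn beta) cX) _.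
  by rewrite mulnA [beta * _]mulnC mulnC leq_mul.
by rewrite expn_gt0 !muln_gt0 q0.
Qed.

(** * Perfect cycle tilings *)

(** Each listed vertex not yet covered closes a path inside its own neighbourhood; the degree leaves
    room after removing the protected set [U] and the earlier tiles. *)
Lemma greedy_cover (G : sgraph) (k t : nat) (U : {set G}) (l : seq G) :
  joined G t -> 0 < t -> 2 < k ->
  (forall v : G, 3 * k * t + #|U| + k * size l <= #|nbrs v|) ->
  exists C : {set G}, [/\ tileable (cycle_graph k) C, [disjoint U & C],
    #|C| <= k * size l & {subset l <= U :|: C}].
Proof.
move=> jG t0 k3; elim: l => [|x l IH] deg.
  exists set0; split=> //; first exact: tileable0.
    by rewrite disjoint_sym disjoints_subset sub0set.
  by rewrite cards0.
have [|C [tC dC cC sC]] := IH.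
  by move=> v; apply: leq_trans (deg v); rewrite leq_add2l leq_mul2l leqnSn orbT.
have cC' : #|C| <= k * size (x :: l).
  by apply: leq_trans cC _; rewrite leq_mul2l leqnSn orbT.
have [xUC|xUC] := boolP (x \in U :|: C).
  exists C; split=> // z; rewrite inE => /orP[/eqP->//|]; exact: sC.
have [||T [sT uT TA tT]] := @exists_star_path G k t set0 (nbrs x :\: (U :|: C)) jG t0 k3.
- by rewrite cards0.
- have := deg x; have := cardsD (nbrs x) (U :|: C).
  have := subset_leq_card (subsetIr (nbrs x) (U :|: C)).
  have : #|U :|: C| <= #|U| + #|C| := leq_card_setU U C; move: cC; rewrite /= mulnS; clear -k3; lia.
have xT : x \notin T.
  by apply/negP => /TA; rewrite !inE adj_irrefl !andbF.
have TN : {subset T <= nbrs x} by move=> z /TA; rewrite in_setD => /andP[/andP[]].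
have dT : [disjoint U :|: C & [set z in x :: T]].
  rewrite disjoint_sym; apply/pred0P => z /=; rewrite [z \in [set _ in _]]inE.
  apply/negP => /andP[]; rewrite inE => /orP[/eqP->|/TA]; first by rewrite (negPf xUC).
  by rewrite in_setD => /andP[/andP[/negPf->]].
move: dT; rewrite disjointsUl => /andP[dU dC'].
exists (C :|: [set z in x :: T]); split.
- by apply: tileableS => //; apply: tT.
- by rewrite disjointsUr dC dU.
- apply: leq_trans (leq_card_setU _ _) _; rewrite mulnS addnC leq_add //.
  by rewrite cardsE; apply: leq_trans (card_size _) _; rewrite /= sT; clear -k3; lia.
move=> z; rewrite inE => /orP[/eqP->|/sC]; first by rewrite !inE eqxx !orbT.
by rewrite !in_setU => /orP[->//|->]; rewrite !orbT.
Qed.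

(** Earlier slots occupy at most [#|G| / (2 * k)] vertices, so half of the guaranteed degree
    survives outside [U] and [exists_slot] applies with [q = 2 * k]; hence
    [16 * k ^ 2 = 4 * (2 * k) ^ 2]. Each slot lacks one vertex modulo [k], whence the divisibility
    of [#|U| + M]. *)
Lemma many_slots (G : sgraph) (k t beta Q M : nat) :
  joined G t -> 3 < k -> 0 < #|G| ->
  (forall v : G, #|G| <= k * #|nbrs v|) ->
  8 * k < #|G| -> 384 * k ^ 4 * t <= #|G| ->
  48 * k ^ 3 * t * beta <= #|G| ->
  (16 * k ^ 2).-1 ^ Q * beta <= (16 * k ^ 2) ^ Q ->
  3 * k * Q + 5 * k < t ->
  2 * k * (M * (3 * k * Q + k)) <= #|G| ->
  exists (S : nat -> {set G}) (X : nat -> {set G}) (U : {set G}),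
    [/\ #|U| <= M * (3 * k * Q + k) /\ k %| #|U| + M,
        forall y, y \in U -> exists2 i, i < M & y \in S i,
        forall i, i < M -> S i \subset U,
        forall i j, i < j < M -> [disjoint S i & S j] &
        forall i, i < M -> beta * #|X i| <= #|G| /\
          forall y, y \notin U -> y \notin X i ->
            tileable (cycle_graph k) (y |: S i)].
Proof.
move=> jG k4 G0 degG h1 h2 h3 h4 h5; set K := 3 * k * Q + k.
elim: M => [|M IH] hM.
  exists (fun=> set0), (fun=> set0), set0; split=> //.
  - by rewrite cards0 mul0n.
  - by move=> y; rewrite inE.
  - by move=> i j /andP[].
have [|S [X [U [[cU kU] covU SU dS tS]]]] := IH.
  by apply: leq_trans hM; rewrite leq_mul2l leq_mul2r leqnSn !orbT.
have dW v : #|G| <= 2 * k * #|~: U :&: nbrs v|.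
  have e : #|nbrs v| <= #|~: U :&: nbrs v| + #|U|.
    by rewrite -(cardsID U (nbrs v)) addnC leq_add ?subset_leq_card ?subsetIr //
       setDE finset.setIC.
  have := degG v; have := leq_mul (leqnn k) e; have := leq_mul (leqnn (2 * k)) cU.
  move: hM; rewrite mulSn mulnDr; clear; lia.
have [|||||S' [X' [uS' WS' [kS' sS'] bX' tS']]] :=
   @exists_slot G k (2 * k) t (~: U) beta Q jG k4 dW G0.
- by rewrite mulnA.
- by apply: leq_trans h2; rewrite !expnS expn0; clear; lia.
- by apply: leq_trans h3; rewrite !expnS expn0; clear; lia.
- by have -> : 4 * (2 * k) * (2 * k) = 16 * k ^ 2 by rewrite !expnS expn0; clear; lia.
- exact: h5.
have dSU : [disjoint U & [set z in S']].
  apply/pred0P=> z /=; rewrite [z \in [set _ in _]]inE; apply/negP => /andP[zU /WS'].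
  by rewrite inE zU.
exists (fun i => if i == M then [set z in S'] else S i).
exists (fun i => if i == M then X' else X i), (U :|: [set z in S']).
have lt i : i < M -> (i == M) = false by move=> iM; apply/eqP => e; rewrite e ltnn in iM.
split.
- have /eqP -> : #|U :|: [set z in S']| == #|U| + #|[set z in S']| by rewrite leq_card_setU.
  rewrite cardsE (card_uniqP uS'); split; first by rewrite mulSn addnC leq_add.
  have -> : #|U| + size S' + M.+1 = #|U| + M + (size S').+1 by clear; lia.
  exact: dvdn_add.
- move=> y; rewrite in_setU => /orP[/covU[i iM yi]|yS].
    by exists i; [exact: ltnW | rewrite lt].
  by exists M; rewrite ?eqxx.
- move=> i; rewrite ltnS leq_eqVlt => /orP[/eqP->|iM]; first by rewrite eqxx subsetUr.
  by rewrite lt //; apply: fintype.subset_trans (SU i iM) (subsetUl _ _).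
- move=> i j /andP[ij]; rewrite ltnS leq_eqVlt => /orP[/eqP jM|jM].
    have iM : i < M by rewrite -jM.
    by rewrite jM eqxx lt //; apply: disjointWl dSU; apply: SU.
  by rewrite !lt ?(ltn_trans ij) //; apply: dS; rewrite ij.
move=> i; rewrite ltnS leq_eqVlt => /orP[/eqP->|iM].
  rewrite eqxx; split=> // y; rewrite in_setU negb_or => /andP[yU yS yX].
  have -> : y |: [set z in S'] = [set z in y :: S'] by apply/setP=> z; rewrite !inE.
  by apply: tS' => //; [rewrite inE | move: yS; rewrite inE].
rewrite lt //; have [b tSi] := tS i iM; split=> // y.
by rewrite in_setU negb_or => /andP[yU _ yX]; apply: tSi.
Qed.

Lemma card_bigcup_le (I T : finType) (P : {set I}) (B : I -> {set T}) :
  #|\bigcup_(i in P) B i| <= \sum_(i in P) #|B i|.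
Proof.
elim/big_ind2: _ => [|A n B' m le1 le2|//]; first by rewrite cards0.
by apply: leq_trans (leq_card_setU _ _) _; apply: leq_add.
Qed.

Section AlmostCover.
Variables (G : sgraph) (k t : nat) (W : {set G}).
Hypotheses (jG : joined G t) (t0 : 0 < t) (k3 : 2 < k) (kt : k <= t).

Definition cycle_packing (P : {set {set G}}) : bool :=
  [&& trivIset P, cover P \subset W & [forall T in P, `[< tile (cycle_graph k) T >]]].

Lemma tile_nonempty (T : {set G}) : tile (cycle_graph k) T -> T != set0.
Proof. by move=> /card_tile; rewrite card_ord -card_gt0 => ->; apply: ltn_trans k3. Qed.

Lemma card_cycle_packing (P : {set {set G}}) :
  cycle_packing P -> #|cover P| = k * #|P|.
Proof.
case/and3P=> tP _ /forall_inP tiP; have := leq_card_cover P; rewrite tP => /leqifP /eqP ->.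
rewrite (eq_bigr (fun=> k)) => [|T /tiP/asboolP/card_tile]; last by rewrite card_ord.
by rewrite sum_nat_const mulnC.
Qed.

Lemma cycle_packingU1 (P : {set {set G}}) (T : {set G}) :
  cycle_packing P -> tile (cycle_graph k) T -> T \subset W :\: cover P ->
  cycle_packing (T |: P) /\ #|T |: P| = #|P|.+1.
Proof.
move=> /and3P[tP cP /forall_inP tiP] tT TW.
have dT : [disjoint T & cover P].
  by apply: disjointWl TW _; rewrite disjoint_sym disjoints_subset setDE setCI setCK subsetUr.
have TP : T \notin P.
  apply/negP=> TP; have := tile_nonempty tT; rewrite -card_gt0 => /card_gt0P[x xT].
  by have := disjointFr dT xT; rewrite (subsetP (bigcup_sup T TP)).
split; last by rewrite cardsU1 TP.
have cT : cover [set T] = T by rewrite /cover big_set1.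
apply/and3P; split.
- apply: trivIsetU; rewrite ?cT //.
  by apply/trivIsetP => A B; rewrite !inE => /eqP-> /eqP->; rewrite eqxx.
- rewrite /cover bigcup_setU big_set1 subUset -/(cover P) cP andbT.
  by apply: fintype.subset_trans TW (subsetDl _ _).
- by apply/forall_inP=> A; rewrite in_setU1 => /orP[/eqP->|/tiP//]; apply/asboolP.
Qed.

Lemma cycle_packing_sub (P Q : {set {set G}}) :
  cycle_packing P -> Q \subset P -> cycle_packing Q.
Proof.
move=> /and3P[tP cP /forall_inP tiP] QP; apply/and3P; split.
- exact: trivIsetS tP.
- apply: fintype.subset_trans cP; apply/bigcupsP => A AQ.
  by apply: bigcup_sup; apply: (subsetP QP).
- by apply/forall_inP=> A /(subsetP QP); apply: tiP.
Qed.

(** The bound on [#|T :\ v|] allows this set to be the forbidden set [F] when a second, disjoint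
    tile is sought. *)
Lemma exists_tile_at (v : G) (L F : {set G}) :
  #|F| <= t -> 3 * k * t <= #|L :&: nbrs v| -> v \notin L ->
  exists T : {set G}, [/\ tile (cycle_graph k) T, T \subset v |: (L :\: F),
     v \in T & #|T :\ v| <= t].
Proof.
move=> cF cL vL; have [T [sT uT TA tT]] := exists_star_path jG t0 k3 cF cL.
have vT : v \notin T by apply: contra vL => /TA; rewrite !inE => /andP[/andP[]].
have e : [set z in v :: T] :\ v = [set z in T].
  by apply/setP=> z; rewrite !inE; case: eqVneq => // ->; rewrite (negPf vT).
exists [set z in v :: T]; split; rewrite ?e.
- by apply: tT => // z /TA; rewrite in_setI => /andP[/andP[]].
- apply/subsetP=> z; rewrite !inE => /orP[->//|/TA]; rewrite !inE.
  by move=> /andP[/andP[-> _] ->]; rewrite orbT.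
- by rewrite !inE eqxx.
- by rewrite cardsE (card_uniqP uT) sT (leq_trans (leq_pred k)).
Qed.

(* If a tile of a maximum packing had two vertices with many neighbours outside
   the packing, it could be replaced by two disjoint tiles through these. So the
   uncovered part sends few more than one edge per uncovered vertex to each of
   the at most [#|G| / k] tiles, against the degree condition. *)
Lemma almost_cover (e : nat) : 0 < e ->
  (forall v, v \in W -> (2 * e).+1 * #|G| <= 2 * e * k * #|W :&: nbrs v|) ->
  12 * e * k ^ 2 * t <= #|G| ->
  exists P, cycle_packing P /\ #|W :\: cover P| <= 12 * e * k ^ 2 * t.
Proof.
move=> e0 deg big.
have P0 : cycle_packing set0.
  apply/and3P; split; first by apply/trivIsetP => A B; rewrite inE.
    by rewrite /cover big_set0 sub0set.
  by apply/forall_inP => A; rewrite inE.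
have [P cP maxP'] := @arg_maxnP _ set0 cycle_packing (fun P => #|P|) P0.
have maxP Q : cycle_packing Q -> #|Q| <= #|P| := maxP' Q.
exists P; split=> //; set L := W :\: cover P.
have light v : v \in L -> #|L :&: nbrs v| < 3 * k * t.
  move=> vL; rewrite ltnNge; apply/negP => heavy.
  have [|||T [tT TL _ _]] := @exists_tile_at v (L :\ v) set0.
  - by rewrite cards0.
  - suff -> : (L :\ v) :&: nbrs v = L :&: nbrs v by [].
    by apply/setP=> z; rewrite !inE; case: eqVneq => // ->; rewrite adj_irrefl !andbF.
  - by rewrite !inE eqxx.
  have [|cP' cT] := @cycle_packingU1 P T cP tT.
    by apply: fintype.subset_trans TL _; rewrite setD0 setD1K.
  by have := maxP _ cP'; rewrite cT ltnn.
have heavy1 T v w : T \in P -> v \in T -> w \in T -> v != w ->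
    3 * k * t <= #|L :&: nbrs v| -> #|L :&: nbrs w| < 3 * k * t.
  move=> TP vT wT vw cv; rewrite ltnNge; apply/negP => cw.
  have Tc : T \subset cover P by apply: bigcup_sup.
  have nL z : z \in T -> z \notin L by move=> /(subsetP Tc) zc; rewrite inE zc.
  have [|T1 [tT1 TL1 vT1 cT1]] := @exists_tile_at v L set0 _ cv (nL v vT).
    by rewrite cards0.
  have [T2 [tT2 TL2 vT2 cT2]] := @exists_tile_at w L (T1 :\ v) cT1 cw (nL w wT).
  have cPT := cycle_packing_sub cP (subsetDl P [set T]).
  have TW : T \subset W by apply: fintype.subset_trans Tc _; case/and3P: cP.
  have cD : cover (P :\ T) = cover P :\: T by apply: coverD1 => //; case/and3P: cP.
  have S1 : T1 \subset W :\: cover (P :\ T).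
    rewrite setD0 in TL1; apply: fintype.subset_trans TL1 _; rewrite cD; apply/subsetP=> z; rewrite !inE.
    by move=> /orP[/eqP->|/andP[/negPf-> ->]]; rewrite ?vT ?(subsetP TW) ?andbF.
  have [cP1 n1] := cycle_packingU1 cPT tT1 S1.
  have S2 : T2 \subset W :\: cover (T1 |: (P :\ T)).
    have -> : cover (T1 |: (P :\ T)) = T1 :|: (cover P :\: T).
      by rewrite -cD /cover bigcup_setU big_set1.
    apply/subsetP=> z zT2; have := subsetP TL2 z zT2.
    rewrite in_setU1 => /orP[/eqP->|].
      rewrite !inE wT (subsetP TW) // orbF andbT.
      apply/negP => /(subsetP TL1); rewrite !inE eq_sym (negPf vw) /=.
      by move: (nL w wT); rewrite !inE => /negPf->.
    rewrite in_setD => /andP[zT1 zL].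
    have zv : z != v by apply: contraTneq zL => ->; apply: nL.
    move: zT1 zL; rewrite !inE zv /= => /negPf-> /andP[/negPf-> ->].
    by rewrite andbF.
  have [cP2 n2] := cycle_packingU1 cP1 tT2 S2.
  have := maxP _ cP2; rewrite n2 n1; have := cardsD1 T P; rewrite TP => ->.
  by rewrite add1n ltnn.
have tileN T : T \in P -> \sum_(w in T) #|L :&: nbrs w| <= #|L| + 3 * k ^ 2 * t.
  move=> TP.
  have cT : #|T| = k.
    case/and3P: cP => _ _ /forall_inP/(_ T TP)/asboolP/card_tile.
    by rewrite card_ord.
  have bd (A : {set G}) : A \subset T -> (forall w, w \in A -> #|L :&: nbrs w| <= 3 * k * t) ->
     \sum_(w in A) #|L :&: nbrs w| <= 3 * k ^ 2 * t.
    move=> AT hA; apply: leq_trans (leq_sum _ hA) _; rewrite sum_nat_const.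
    apply: leq_trans (leq_mul (subset_leq_card AT) (leqnn _)) _.
    by rewrite cT !expnS expn0; clear; lia.
  have [/exists_inP[v vT cv]|] := boolP [exists v in T, 3 * k * t <= #|L :&: nbrs v|].
    rewrite (big_setD1 v vT) leq_add ?subset_leq_card ?subsetIl //.
    apply: bd; first exact: subsetDl.
    move=> w; rewrite !inE => /andP[wv wT]; apply/ltnW/(heavy1 T v w) => //.
    by rewrite eq_sym.
  rewrite negb_exists_in => /forall_inP h; apply: leq_trans (leq_addl _ _).
  by apply: bd => // w /h; rewrite -ltnNge => /ltnW.
have cPn : k * #|P| <= #|G| by rewrite -(card_cycle_packing cP) max_card.
pose l := #|L|.
have up : \sum_(v in L) #|W :&: nbrs v| <= l * (3 * k * t) + #|P| * (l + 3 * k ^ 2 * t).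
  apply: leq_trans (_ : \sum_(v in L) (#|L :&: nbrs v| + \sum_(T in P) #|T :&: nbrs v|) <= _).
    apply: leq_sum => v vL.
    apply: leq_trans (_ : #|(L :&: nbrs v) :|: \bigcup_(T in P) (T :&: nbrs v)| <= _).
      apply/subset_leq_card/subsetP=> z; rewrite in_setI => /andP[zW zv].
      rewrite in_setU !in_setI in_setD zW zv !andbT.
      have [/bigcupP[T TP zT]|//] := boolP (z \in cover P).
      by apply/bigcupP; exists T => //; rewrite in_setI zT.
    apply: leq_trans (leq_card_setU _ _) _; rewrite leq_add2l.
    exact: card_bigcup_le.
  rewrite big_split leq_add //.
    by rewrite -sum_nat_const; apply: leq_sum => v /light/ltnW.
  rewrite exchange_big -sum_nat_const; apply: leq_sum => T TP.
  apply: leq_trans (tileN T TP); apply: eq_leq.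
  under eq_bigr do rewrite setI_nbrs -sum1dep_card big_mkcondr.
  under [RHS]eq_bigr do rewrite setI_nbrs -sum1dep_card big_mkcondr.
  rewrite exchange_big; apply: eq_bigr => w _; apply: eq_bigr => v _.
  by rewrite adj_sym.
have lo : l * ((2 * e).+1 * #|G|) <= 2 * e * k * \sum_(v in L) #|W :&: nbrs v|.
  rewrite big_distrr -sum_nat_const; apply: leq_sum => v; rewrite inE => /andP[_].
  exact: deg.
rewrite leqNgt; apply/negP; rewrite -/L -/l => contr.
have h1 := leq_trans lo (leq_mul (leqnn (2 * e * k)) up).
have h2 := leq_mul cPn (leqnn (2 * e * (l + 3 * k ^ 2 * t))).
(* The tiles number at most [#|G| / k] and contribute [l] each, which cancels [2 * e * l * #|G|] of
   the lower bound; the surplus [l * #|G|] is left against terms of order [t]. *)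
have h3 : l * #|G| <= 6 * e * k ^ 2 * t * l + 6 * e * k ^ 2 * t * #|G|.
  by move: h1 h2; rewrite !expnS expn0; clear; lia.
have h4 := leq_mul big (leqnn l).
have G0 : 0 < #|G|.
  have k0 : 0 < k by apply: ltn_trans k3.
  by apply: leq_trans big; rewrite !muln_gt0 e0 t0 ?expn_gt0 k0.
have h5 : 12 * e * k ^ 2 * t * #|G| < l * #|G| by rewrite ltn_pmul2r.
by move: h3 h4 h5; clear; lia.
Qed.

End AlmostCover.

(** [M] counts the slots. It must exceed the leftover of [almost_cover] and reach [2 * #|G| / beta]
    for the final matching. Slots and greedy tiles together occupy at most [#|G| / (4 * e * k)]
    vertices, so the relative degree surplus [1 / e] drops to no less than [1 / (2 * e)]. *)
Lemma cycle_perfect (G : sgraph) (k e t beta Q M : nat) :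
  joined G t -> 3 < k -> 0 < e -> k %| #|G| -> 0 < #|G| ->
  (forall v : G, e.+1 * #|G| <= e * k * #|nbrs v|) ->
  8 * k < #|G| -> 384 * k ^ 4 * t <= #|G| ->
  48 * k ^ 3 * t * beta <= #|G| ->
  (16 * k ^ 2).-1 ^ Q * beta <= (16 * k ^ 2) ^ Q ->
  3 * k * Q + 5 * k < t ->
  4 * e * k * (M * (3 * k * Q + k + k)) <= #|G| ->
  12 * e * k ^ 2 * t <= M -> 2 * #|G| <= beta * M ->
  has_perfect_tiling (cycle_graph k) G.
Proof.
move=> jG k4 e0 kG G0 deg h1 h2 h3 h4 h5 hM tM nM.
have k0 : 0 < k by apply: leq_trans k4.
have t0 : 0 < t by apply: leq_ltn_trans h5.
have degk (v : G) : #|G| <= k * #|nbrs v|.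
  rewrite -(leq_pmul2l e0) mulnA; apply: leq_trans (deg v).
  by rewrite leq_mul2r leqnSn orbT.
have M0 : 0 < M.
  by apply: leq_trans tM; rewrite !muln_gt0 e0 t0 ?expn_gt0 k0.
have b0 : 0 < beta by case: (beta) nM => //; rewrite mul0n leqNgt muln_gt0 G0.
set K := 3 * k * Q + k in hM.
have hM1 : 4 * k * (M * K + M * k) <= #|G|.
  apply: leq_trans hM; rewrite -mulnDr leq_mul2r; apply/orP; right.
  by rewrite leq_mul2r leq_pmulr ?orbT.
have [|S [X [U [[cU kU] covU SU dS tS]]]] :=
    @many_slots G k t beta Q M jG k4 G0 degk h1 h2 h3 h4 h5.
  by apply: leq_trans hM1; rewrite -/K; clear; lia.
(* The vertices that too many slots cannot absorb are covered greedily first. *)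
pose X0 := [set y in ~: U | M < 2 * #|[set i : 'I_M | y \in X i]| ].
(* Each [X i] has at most [#|G| / beta] elements, so at most [2 * #|G| / beta <= M] vertices are
   rejected by more than half of the slots. *)
have cX0 : #|X0| <= M.
  have d1 : #|X0| * M <= 2 * \sum_(i < M) #|X i|.
    apply: leq_trans (_ : 2 * \sum_(y in X0) #|[set i : 'I_M | y \in X i]| <= _).
      rewrite big_distrr -sum_nat_const; apply: leq_sum => y.
      by rewrite inE => /andP[_ /ltnW].
    rewrite leq_mul2l /=.
    under eq_bigr do rewrite -sum1dep_card big_mkcond.
    rewrite exchange_big; apply: leq_sum => i _.
    rewrite -big_mkcondr sum1dep_card; apply/subset_leq_card/subsetP=> y.
    by rewrite inE => /andP[].
  have d2 : beta * \sum_(i < M) #|X i| <= M * #|G|.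
    rewrite big_distrr -[X in X * _]card_ord -sum_nat_const.
    by apply: leq_sum => i _; have [] := tS i (ltn_ord i).
  rewrite -(leq_pmul2l b0) -(leq_pmul2r M0).
  have := leq_mul (leqnn beta) d1; have := leq_mul (leqnn 2) d2.
  by have := leq_mul (leqnn M) nM; clear; lia.
have [|v|C [tC dC cC sC]] := @greedy_cover G k t U (enum X0) jG t0.
- by apply: ltnW.
- rewrite -(leq_pmul2l k0); apply: leq_trans (degk v).
  have : k * (k * size (enum X0)) <= k * (M * k).
    by rewrite -cardE leq_mul2l mulnC leq_mul2r cX0 !orbT.
  have := leq_mul (leqnn k) cU; rewrite -/K.
  by move: hM1 h2; rewrite !expnS expn0; have := leq_mul (leq_mul k4 k4) (leqnn (k * k * t)); clear; lia.
rewrite -cardE in cC.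
pose W := ~: (U :|: C).
have cUC : #|U :|: C| <= M * K + M * k.
  apply: leq_trans (leq_card_setU _ _) _; rewrite leq_add //.
  by apply: leq_trans cC _; rewrite mulnC leq_mul2r cX0 orbT.
have kt : k <= t by apply: leq_trans (ltnW h5); clear; lia.
have degW v : v \in W -> (2 * e).+1 * #|G| <= 2 * e * k * #|W :&: nbrs v|.
  move=> _.
  have : #|nbrs v| <= #|W :&: nbrs v| + #|U :|: C|.
    by rewrite -(cardsID (U :|: C) (nbrs v)) addnC leq_add ?subset_leq_card ?subsetIr //
       setDE finset.setIC.
  move=> /(leq_mul (leqnn (2 * e * k))); have := deg v.
  have := leq_mul (leqnn (2 * e * k)) cUC.
  by move: hM; clear; lia.
have cMG : M <= #|G|.
  apply: leq_trans hM1; rewrite mulnDr; apply: leq_trans (leq_addl _ _).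
  by rewrite mulnCA leq_pmulr // !muln_gt0 k0.
have [|P [pP cL]] := almost_cover jG t0 (ltnW k4) kt e0 degW.
  exact: leq_trans cMG.
have cP := card_cycle_packing pP.
have PW : cover P \subset W by case/and3P: pP.
have cW : #|G| = #|U| + #|C| + #|W|.
  have /eqP <- : #|U :|: C| == #|U| + #|C| by rewrite leq_card_setU.
  by rewrite -(cardsC (U :|: C)).
have kC : k %| #|C| by have := dvdn_tileable tC; rewrite card_ord.
have MW : M <= #|W|.
  have : #|U| + #|C| <= M * K + M * k.
    by have /eqP <- : #|U :|: C| == #|U| + #|C| by rewrite leq_card_setU.
  have : M * k <= k * (M * k) by rewrite leq_pmull.
  have : M * K <= k * (M * K) by rewrite leq_pmull.
  have : M <= M * k by rewrite leq_pmulr.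
  by move: hM1; rewrite cW; clear; lia.
have kW : k %| #|W| - M.
  have e1 : #|G| = (#|U| + M) + (#|C| + (#|W| - M)) by rewrite cW; move: MW; clear; lia.
  by move: kG; rewrite e1 dvdn_addr // dvdn_addr.
(* Keep only so many tiles that exactly [M] vertices, one per slot, are left. *)
have [|P' P'P cP'] := @subset_of_card _ P ((#|W| - M) %/ k).
  rewrite -(leq_pmul2l k0) -cP mulnC divnK //.
  have := cardsD W (cover P); rewrite (setIidPr PW) => e1.
  have := leq_trans cL tM; rewrite e1; clear; lia.
have pP' := cycle_packing_sub pP P'P.
have cP'' := card_cycle_packing pP'.
rewrite cP' mulnC divnK // in cP''.
have P'W : cover P' \subset W by case/and3P: pP'.
pose L := W :\: cover P'.
have cardL : #|L| = M.
  by rewrite cardsD (setIidPr P'W) cP''; apply: subKn.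
have LU x : x \in L -> x \notin U by rewrite !inE negb_or => /andP[_ /andP[]].
have LX0 x : x \in L -> M <= 2 * #|[set i : 'I_M | x \notin X i]|.
  move=> xL; have : x \notin X0.
    apply/negP => xX; have := sC x; rewrite mem_enum => /(_ xX).
    by move: xL; rewrite inE in_setC => /andP[_ /negPf->].
  rewrite inE in_setC LU //= -leqNgt.
  have := cardsC [set i : 'I_M | x \in X i]; rewrite card_ord.
  have -> : ~: [set i : 'I_M | x \in X i] = [set i : 'I_M | x \notin X i].
    by apply/setP=> i; rewrite !inE.
  have ar a b c : a + b = c -> 2 * a <= c -> c <= 2 * b by clear; lia.
  exact: ar.
pose R (x : G) (i : 'I_M) : bool := x \notin X i.
(* If [2 * #|A| <= M], a single vertex of [A] is accepted by enough slots, as it lies outside [X0].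
   If [A] is larger, every slot accepts some vertex of [A]: otherwise [A] would lie in one [X i],
   which is too small. *)
have [|f [fi fR]] := @hall G 'I_M (Ordinal M0) R L.
  move=> A AL; have [->|[x xA]] := set_0Vmem A; first by rewrite cards0.
  have [small|large] := leqP (2 * #|A|) M.
    rewrite -(leq_pmul2l (_ : 0 < 2)) //; apply: leq_trans small _.
    apply: leq_trans (LX0 x (subsetP AL x xA)) _; rewrite leq_mul2l /=.
    apply/subset_leq_card/subsetP=> i; rewrite inE => xi.
    by apply/nbhd_setP; exists x.
  apply: leq_trans (_ : M <= _); first by rewrite -cardL subset_leq_card.
  rewrite -[X in X <= _]card_ord -cardsT; apply/subset_leq_card/subsetP=> i _.
  rewrite inE; apply: contraT; rewrite negb_exists_in => /forall_inP AX.
  have : #|A| <= #|X i| by apply/subset_leq_card/subsetP=> y /AX; rewrite negbK.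
  have [bX _] := tS i (ltn_ord i) => AXi.
  have hA : beta * M < beta * (2 * #|A|) by rewrite ltn_pmul2l.
  by have := leq_mul (leqnn (2 * beta)) AXi; move: bX nM hA; clear; lia.
have fsurj (i : 'I_M) : exists2 x, x \in L & f x = i.
  have : i \in f @: L.
    suff -> : f @: L = setT by rewrite inE.
    by apply/eqP; rewrite eqEcard subsetT card_in_imset // cardsT card_ord cardL leqnn.
  by case/imsetP => x xL ->; exists x.
apply: tileable_perfect.
have tL : tileable (cycle_graph k) (\bigcup_(x in L) (x |: S (f x))).
  apply: tileable_bigcup => [x xL|x y xL yL xy].
    have [_] := tS (f x) (ltn_ord _); apply; [exact: LU | exact: fR].
  have nS z (i : 'I_M) : z \in L -> z \notin S i.
    by move=> /LU; apply: contra; apply/subsetP/SU.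
  rewrite disjointsUl !disjointsUr !disjoints1 !in_set1 xy nS //=.
  rewrite disjoint_sym disjoints1 nS //=.
  have : f x != f y by apply: contra xy => /eqP/fi ->.
  rewrite neq_ltn => /orP[lt|lt]; last rewrite disjoint_sym;
    by apply: dS; rewrite lt ltn_ord.
have tP' : tileable (cycle_graph k) (cover P').
  case/and3P: pP' => /trivIsetP tr _ /forall_inP ti.
  apply: tileable_bigcup => [T TP|A B]; last exact: tr.
  by apply/tileable_tile/asboolP/ti.
have -> : [set: G] = C :|: cover P' :|: \bigcup_(x in L) (x |: S (f x)).
  apply/esym/setP => z; rewrite [RHS]inE; apply/negPn/negP.
  rewrite !in_setU !negb_or => /andP[/andP[zC zP] /negP zL].
  have [zU|zU] := boolP (z \in U).
    have [i iM zi] := covU z zU; have [x xL fx] := fsurj (Ordinal iM).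
    by apply: zL; apply/bigcupP; exists x => //; rewrite in_setU fx zi orbT.
  have zL' : z \in L by rewrite inE zP in_setC in_setU negb_or zU.
  by apply: zL; apply/bigcupP; exists z; rewrite ?setU11.
have LS x : x \in L -> x |: S (f x) \subset L :|: U.
  move=> xL; rewrite subUset sub1set in_setU xL /=.
  by apply: fintype.subset_trans (SU _ (ltn_ord _)) (subsetUr _ _).
have dCP : [disjoint C & cover P'].
  rewrite disjoint_sym; apply: disjointWl P'W _.
  by rewrite disjoints_subset /W setCS subsetUr.
apply: tileableU => //; first exact: tileableU.
apply/bigcup_disjointP => x xL; rewrite disjoint_sym.
apply: disjointWl (LS x xL) _.
rewrite disjointsUl !disjointsUr dC /=; apply/andP; split.
  apply/andP; split; rewrite disjoints_subset /L.
    by rewrite setDE; apply: fintype.subset_trans (subsetIl _ _) _; rewrite /W setCS subsetUr.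
  by rewrite setDE subsetIr.
rewrite disjoint_sym; apply: disjointWl P'W _.
by rewrite disjoints_subset /W setCS subsetUl.
Qed.

(** * Perfect tree tilings *)

(** A lower-tail estimate with a union bound over [J], for a uniformly random [f]. In the
    application [j] is a vertex with a class, [i] a block, and agreement at [i] gives the vertex a
    neighbour in the class. *)
Lemma exists_agreeing (N k : nat) (J : finType) (g : J -> 'I_N -> option 'I_k)
    (d m : nat) : 0 < k ->
  (forall j, d <= #|[set i | g j i != None]|) ->
  #|J| * 2 ^ m * (2 * k).-1 ^ d < (2 * k) ^ d ->
  exists f : {ffun 'I_N -> 'I_k},
    forall j, m <= #|[set i | g j i == Some (f i)]|.
Proof.
move=> k0 gd lt; apply: contrapT => nex.
(* First moment method, with [w j f = 2 ^ (N - number of agreements)]. *)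
pose w j (f : {ffun 'I_N -> 'I_k}) := \prod_i (if g j i == Some (f i) then 1 else 2).
have wE j f : w j f * 2 ^ #|[set i | g j i == Some (f i)]| = 2 ^ N.
  rewrite -[in RHS](card_ord N) -!prod_nat_const [X in _ * X]big_mkcond -big_split /=.
  by apply: eq_bigr => i _; rewrite inE; case: ifP.
(* Where [g j] is defined, the [k] labels have total weight [2 * k - 1] instead of [2 * k], so the
   mean weight is at most [2 ^ N * (1 - 1 / (2 * k)) ^ d]. A failure at [j] has weight above
   [2 ^ (N - m)]. *)
have sw j : (\sum_f w j f) * (2 * k) ^ d <= (2 * k).-1 ^ d * (2 * k) ^ N.
  rewrite -(bigA_distr_bigA (fun i c => if g j i == Some c then 1 else 2)) /=.
  pose D := [set i | g j i != None].
  have e i : \sum_(c < k) (if g j i == Some c then 1 else 2) =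
      if i \in D then (2 * k).-1 else 2 * k.
    rewrite inE; case: (g j i) => [c0|] /=.
      rewrite (bigD1 c0) //= eqxx (eq_bigr (fun=> 2)) => [|c cc0].
        rewrite sum_nat_const cardC1 card_ord; have := ltn_ord c0; lia.
      by case: eqP => // -[e]; rewrite e eqxx in cc0.
    by rewrite sum_nat_const card_ord mulnC.
  under eq_bigr do rewrite e.
  have -> : \prod_i (if i \in D then (2 * k).-1 else 2 * k) =
      (2 * k).-1 ^ #|D| * (2 * k) ^ #|~: D|.
    rewrite (bigID (mem D)) /=; congr (_ * _).
      by rewrite -prod_nat_const; apply: eq_bigr => i ->.
    rewrite -prod_nat_const; apply: eq_big => [i|i /negPf->//].
    by rewrite in_setC.
  have cD : #|D| + #|~: D| = N by rewrite cardsC card_ord.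
  have -> : (2 * k) ^ N = (2 * k) ^ #|D| * (2 * k) ^ #|~: D| by rewrite -expnD cD.
  rewrite -(subnKC (gd j)) -/D !expnD.
  set a := (2 * k).-1; set b := 2 * k.
  have ab x : a ^ x <= b ^ x by case: x => // x; rewrite leq_exp2r // leq_pred.
  move: (ab (#|D| - d)) => /(leq_mul (leqnn (a ^ d * b ^ d * b ^ #|~: D|))).
  move: (a ^ d) (b ^ d) (a ^ _) (b ^ (_ - _)) (b ^ #|~: D|) => A B P Q C.
  by clear; lia.
have tot : k ^ N * 2 ^ N <= \sum_j \sum_f 2 ^ m * w j f.
  rewrite exchange_big /=.
  have -> : k ^ N * 2 ^ N = \sum_(f : {ffun 'I_N -> 'I_k}) 2 ^ N.
    by rewrite sum_nat_const card_ffun !card_ord.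
  apply: leq_sum => f _.
  have [j] : exists j, #|[set i | g j i == Some (f i)]| < m.
    apply: contrapT => nj; apply: nex; exists f => j.
    by rewrite leqNgt; apply/negP => lj; apply: nj; exists j.
  move=> lj; rewrite (bigD1 j) //=; apply: leq_trans (leq_addr _ _).
  by rewrite -(wE j f) mulnC leq_mul // leq_exp2l // ltnW.
have : (2 * k) ^ N * (2 * k) ^ d <= #|J| * 2 ^ m * (2 * k).-1 ^ d * (2 * k) ^ N.
  apply: leq_trans (_ : (\sum_j \sum_f 2 ^ m * w j f) * (2 * k) ^ d <= _).
    by rewrite leq_mul // expnMn mulnC.
  rewrite big_distrl /=.
  apply: leq_trans (_ : \sum_(j in J) 2 ^ m * ((2 * k).-1 ^ d * (2 * k) ^ N) <= _).
    by apply: leq_sum => j _; rewrite -big_distrr /= -mulnA leq_mul.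
  by rewrite sum_nat_const !mulnA.
by rewrite mulnC leq_pmul2r ?expn_gt0 ?muln_gt0 ?k0 // leqNgt lt.
Qed.

Lemma modn_addr_inj k a b s : a < k -> b < k -> (a + s) %% k = (b + s) %% k -> a = b.
Proof. by move=> ak bk /eqP; rewrite eqn_modDr !modn_small // => /eqP. Qed.

(* Cut [G] into [N] blocks of [#|T|] vertices and choose independent cyclic
   shifts of the blocks. *)
Lemma exists_equipartition (G T : finType) (r : rel G) (N d m : nat) :
  0 < #|T| -> #|G| = N * #|T| ->
  (forall v : G, d * #|T| <= #|[set y | r v y]|) ->
  #|G| * #|T| * 2 ^ m * (2 * #|T|).-1 ^ d < (2 * #|T|) ^ d ->
  exists p : G -> T, (forall c, #|[set v | p v == c]| = N) /\
    forall v c, m <= #|[set y | r v y && (p y == c)]|.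
Proof.
set k := #|T| => k0 cG deg lt.
have blkP (v : G) : enum_rank v %/ k < N by rewrite ltn_divLR // -cG.
have posP (v : G) : enum_rank v %% k < k by rewrite ltn_mod.
pose blk v := Ordinal (blkP v); pose pos v := Ordinal (posP v).
have bp_inj v w : blk v = blk w -> pos v = pos w -> v = w.
  move=> [e1] [e2]; apply/enum_rank_inj/val_inj => /=.
  by rewrite (divn_eq (enum_rank v) k) (divn_eq (enum_rank w) k) e1 e2.
have shP (c s : 'I_k) : (c + s) %% k < k by rewrite ltn_mod.
pose sh c s := Ordinal (shP c s).
have bkP (t c : 'I_k) : (t + (k - c)) %% k < k by rewrite ltn_mod.
pose bk t c := Ordinal (bkP t c).
have shK t c : sh c (bk t c) = t.
  apply/val_inj => /=; rewrite modnDmr addnCA subnKC ?modnDr ?modn_small //.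
  exact: ltnW.
(* The shift of block [i] that moves one chosen neighbour of the vertex into the class; undefined if
   the block contains no neighbour. *)
pose g (vt : G * 'I_k) (i : 'I_N) : option 'I_k :=
  if [pick y | r vt.1 y && (blk y == i)] is Some y then Some (bk vt.2 (pos y)) else None.
have [||f fm] := @exists_agreeing N k _ g d m k0.
(* Blocks have [k] vertices, so [d * k] neighbours meet at least [d] blocks. *)
- move=> [v t]; rewrite -(leq_pmul2r k0); apply: leq_trans (deg v) _.
  apply: leq_trans (_ : #|setX [set i | g (v, t) i != None] [set: 'I_k]| <= _); last first.
    by rewrite cardsX cardsT card_ord.
  rewrite -(card_imset [set y | r v y] (_ : injective (fun y => (blk y, pos y)))).
    apply/subset_leq_card/subsetP=> _ /imsetP[y ry ->]; rewrite !inE andbT /g /=.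
    case: pickP => [//|/(_ y)]; move: ry; by rewrite inE => ->; rewrite eqxx.
  by move=> y z [] *; apply: bp_inj; apply/val_inj.
- by rewrite card_prod card_ord.
pose p0 y := sh (pos y) (f (blk y)).
have p0_inj v w : blk v = blk w -> p0 v = p0 w -> v = w.
  rewrite /p0 => e1; rewrite e1 => -[e2]; apply: (bp_inj _ _ e1); apply/val_inj => /=.
  by apply: (@modn_addr_inj k _ _ (f (blk w))) => //; rewrite ltn_mod.
pose cl t := [set v | p0 v == t].
(* A class takes at most one vertex from each of the [N] blocks; the total [N * k] then forces
   equality for every class. *)
have cl_le t : #|cl t| <= N.
  rewrite -[X in _ <= X]card_ord -(card_in_imset (_ : {in cl t &, injective blk})).
    exact: max_card.
  by move=> v w; rewrite !inE => /eqP ev /eqP ew e; apply: p0_inj e _; rewrite ev ew.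
have sum_cl : \sum_t #|cl t| = N * k.
  rewrite -cG -sum1_card (partition_big p0 predT) //.
  by apply: eq_bigr => t _; rewrite /= sum1dep_card.
have clN t : #|cl t| = N.
  apply/eqP; rewrite eqn_leq cl_le /=; rewrite leqNgt; apply/negP => lt1.
  have : \sum_t #|cl t| < \sum_(t < k) N.
    rewrite (bigD1 t) //= [X in _ < X](bigD1 t) //= -addSn leq_add //.
    exact: leq_sum.
  by rewrite sum_cl sum_nat_const card_ord mulnC ltnn.
pose th (c : 'I_k) : T := enum_val c.
have th_inj : injective th := enum_val_inj.
have th_eq (c : T) : exists t, c = th t by exists (enum_rank c); rewrite /th enum_rankK.
exists (fun y => th (p0 y)); split=> [c|v c]; have [t ->] := th_eq c.
  by rewrite -(clN t); apply: eq_card => y; rewrite !inE (inj_eq th_inj).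
apply: leq_trans (fm (v, t)) _.
apply: leq_trans (_ : #|blk @: [set y | r v y & th (p0 y) == th t]| <= _); last exact: leq_imset_card.
apply/subset_leq_card/subsetP=> i; rewrite inE /g /=.
case: pickP => // y /andP[ry /eqP yi] /eqP[e]; apply/imsetP; exists y => //.
by rewrite inE ry (inj_eq th_inj) /p0 yi -e shK eqxx.
Qed.

(** Hall's condition: fewer than [s] vertices are served by the neighbourhood of one of them. A
    larger [S] misses fewer than [s] vertices of [B], and any missed vertex has [s] neighbours
    outside [S], so [#|S| <= N - s]. *)
Lemma joined_matching (G : sgraph) (s N : nat) (A B : {set G}) :
  joined G s -> 0 < s -> [disjoint A & B] -> #|A| = N -> #|B| = N ->
  (forall a, a \in A -> s <= #|B :&: nbrs a|) ->
  (forall b, b \in B -> s <= #|A :&: nbrs b|) ->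
  exists f : G -> G, {in A &, injective f} /\
    forall x, x \in A -> (f x \in B) && adj x (f x).
Proof.
move=> jG s0 dAB cA cB dA dB.
have [->|[a0 _]] := set_0Vmem A.
  by exists id; split=> [x y|x]; rewrite inE.
pose R (x y : G) : bool := (y \in B) && adj x y.
suff [f [fi fR]] : exists f : G -> G, {in A &, injective f} /\ forall x, x \in A -> R x (f x).
  by exists f.
apply: hall => // S SA; have [->|[x xS]] := set_0Vmem S; first by rewrite cards0.
have NB : nbhd_set R S \subset B.
  by apply/subsetP=> y /nbhd_setP[z _ /andP[]].
have [small|large] := ltnP #|S| s.
  apply: leq_trans (ltnW small) _; apply: leq_trans (dA x (subsetP SA x xS)) _.
  apply/subset_leq_card/subsetP=> y; rewrite !inE => /andP[yB xy].
  by apply/exists_inP; exists x => //; rewrite /R yB.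
have [e|[y yB]] := set_0Vmem (B :\: nbhd_set R S).
  have := cardsD B (nbhd_set R S); rewrite e cards0 (setIidPr NB) cB.
  by have := subset_leq_card SA; rewrite cA; clear; lia.
have h1 : s <= #|A :\: S|.
  move: (yB); rewrite in_setD => /andP[yN yB'].
  apply: leq_trans (dB y yB') _; apply/subset_leq_card/subsetP=> z.
  rewrite in_setI in_setD => /andP[-> yz]; rewrite andbT; apply: contra yN => zS.
  by apply/nbhd_setP; exists z => //; rewrite /R yB' adj_sym; move: yz; rewrite inE.
have h2 : #|B :\: nbhd_set R S| < s.
  rewrite ltnNge; apply/negP => le.
  have [|z [w [zS wB zw]]] := @jG S (B :\: nbhd_set R S) _ large le.
    by apply: disjointWl SA _; apply: disjointWr dAB; apply: subsetDl.
  move: wB; rewrite in_setD => /andP[/negP wN wB]; apply: wN.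
  by apply/nbhd_setP; exists z => //; rewrite /R wB.
have := cardsD B (nbhd_set R S); have := cardsD A S.
rewrite (setIidPr NB) (setIidPr SA) cA cB.
by have := subset_leq_card SA; rewrite cA; move: h1 h2; clear; lia.
Qed.

Definition connected_in (T : sgraph) (S : {set T}) : Prop :=
  {in S &, forall x y, connect (fun a b => [&& adj a b, a \in S & b \in S]) x y}.

(** A second neighbour of [v] in [S] would close a cycle with a path inside [S]. Hence a tree can be
    built up vertex by vertex, with a single new edge each time. *)
Lemma tree_grow (T : sgraph) (S : {set T}) :
  is_tree T -> S != set0 -> S != setT -> connected_in S ->
  exists u v, [/\ u \in S, v \notin S, adj u v,
    forall w, w \in S -> adj w v -> w = u & connected_in (v |: S)].
Proof.
move=> [[_ cT] aT] S0 ST cS.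
have [x xS] : exists x, x \in S by apply/set0Pn.
have [y yS] : exists y, y \notin S.
  apply/existsP; rewrite -negb_forall; apply: contra ST => /forallP h.
  by apply/eqP/setP=> z; rewrite inE h.
have [u [v [uS vS uv]]] : exists u v, [/\ u \in S, v \notin S & adj u v].
  have /connectP[p pp ey] := cT x y.
  elim: p x xS pp ey => [|z p IH] x xS /=; first by move=> _ e; rewrite e xS in yS.
  case/andP=> xz pz e; have [zS|zS] := boolP (z \in S); last by exists x, z.
  exact: IH zS pz e.
exists u, v; split=> //.
- move=> w wS wv; apply/eqP/negPn/negP => wu.
  have /connectP[p0 pp0 ew0] := cS u w uS wS.
  case/shortenP: pp0 ew0 => p pp up _ ew.
  have pS z : z \in p -> z \in S.
    move=> zp; have := pp; case/splitPr: zp => p1 p2.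
    by rewrite cat_path /= => /and3P[_ /and3P[]].
  apply: (aT [:: v, u & p]).
    by case: (p) ew => //= e; rewrite e eqxx in wu.
  rewrite /ucycle /= rcons_path -ew wv adj_sym uv !andbT.
  apply/andP; split; first by apply: sub_path pp => a b /andP[].
  rewrite -/(uniq [:: v, u & p]) cons_uniq up andbT inE negb_or.
  apply/andP; split; first by apply: contraNneq vS => ->.
  by apply: contra vS => /pS.
have sub a b : a \in S -> b \in S ->
    connect (fun a b => [&& adj a b, a \in v |: S & b \in v |: S]) a b.
  move=> aS bS; apply: connect_sub (cS a b aS bS) => c d /and3P[cd cS' dS].
  by apply: connect1; rewrite cd !in_setU1 cS' dS !orbT.
have vu : connect (fun a b => [&& adj a b, a \in v |: S & b \in v |: S]) v u.
  by apply: connect1; rewrite adj_sym uv !in_setU1 eqxx uS orbT.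
have uv' : connect (fun a b => [&& adj a b, a \in v |: S & b \in v |: S]) u v.
  by apply: connect1; rewrite uv !in_setU1 eqxx uS orbT.
move=> a b; rewrite !in_setU1 => /orP[/eqP->|aS] /orP[/eqP->|bS] //.
- exact: connect_trans vu (sub _ _ uS bS).
- exact: connect_trans (sub _ _ aS uS) uv'.
- exact: sub.
Qed.

Lemma tree_perfect (G T : sgraph) (N d s : nat) :
  is_tree T -> joined G s -> 0 < s -> #|G| = N * #|T| ->
  (forall v : G, d * #|T| <= #|nbrs v|) ->
  #|G| * #|T| * 2 ^ s * (2 * #|T|).-1 ^ d < (2 * #|T|) ^ d ->
  has_perfect_tiling T G.
Proof.
move=> tT jG s0 cG deg lt; have T0 : 0 < #|T| by case: tT => [[]].
have [p [pN pd]] := exists_equipartition T0 cG deg lt.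
pose cl c := [set v | p v == c].
have match_uv u v : u != v -> exists f : G -> G, {in cl u &, injective f} /\
    forall x, x \in cl u -> (f x \in cl v) && adj x (f x).
  move=> uv; apply: joined_matching jG s0 _ (pN u) (pN v) _ _.
  - apply/pred0P=> z /=; rewrite !inE; apply/negP => /andP[/eqP-> e].
    by rewrite e in uv.
  - by move=> a _; apply: leq_trans (pd a v) _; apply/eq_leq/eq_card => z; rewrite !inE andbC.
  - by move=> a _; apply: leq_trans (pd a u) _; apply/eq_leq/eq_card => z; rewrite !inE andbC.
have /card_gt0P[r _] := T0.
(* [Phi x] is the partial copy of [T] rooted at [x], sending [v] into class [v]. A new vertex [v]
   attached at [u] is placed by the matching from class [u] to class [v], and its only edge to
   earlier vertices is the matching edge. *)
have ext n : n < #|T| -> exists (S : {set T}) (Phi : G -> T -> G),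
   [/\ #|S| = n.+1, connected_in S,
     forall v, v \in S -> {in cl r &, injective (Phi^~ v)},
     forall x v, x \in cl r -> v \in S -> p (Phi x v) = v &
     forall x u v, x \in cl r -> u \in S -> v \in S -> adj u v -> adj (Phi x u) (Phi x v)].
  elim: n => [_|n IH nT].
    exists [set r], (fun x _ => x); split=> //.
    - by rewrite cards1.
    - by move=> x y; rewrite !inE => /eqP-> /eqP->; apply: connect0.
    - by move=> v _ x y _ _.
    - by move=> x v; rewrite !inE => /eqP-> /eqP->.
    - by move=> x u v _; rewrite !inE => /eqP-> /eqP->; rewrite adj_irrefl.
  have [S [Phi [cS coS inj cls hom]]] := IH (ltnW nT).
  have [||u [v [uS vS uv only co']]] := @tree_grow T S tT _ _ coS.
  - by rewrite -card_gt0 cS.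
  - by apply: contraTneq nT => e; rewrite -cS e cardsT ltnn.
  have nuv : u != v by apply: contraNneq vS => <-.
  have [f [fi fc]] := match_uv u v nuv.
  have clP x : x \in cl r -> Phi x u \in cl u by move=> xr; rewrite inE cls.
  exists (v |: S), (fun x w => if w == v then f (Phi x u) else Phi x w); split=> //.
  - by rewrite cardsU1 vS cS.
  - move=> w; rewrite in_setU1; have [_ _|_ /= wS] := eqVneq w v; last exact: inj.
    by move=> x y xr yr /fi e; apply: (inj u uS) => //; apply: e; apply: clP.
  - move=> x w xr; rewrite in_setU1; have [-> _|_ /= wS] := eqVneq w v; last exact: cls.
    by have /andP[] := fc _ (clP x xr); rewrite inE => /eqP.
  move=> x w z xr; rewrite !in_setU1.
  have [->|wv] /= := eqVneq w v; have [->|zv] /= := eqVneq z v.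
  - by rewrite adj_irrefl.
  - move=> _ zS; rewrite adj_sym => /(only z zS)->.
    by rewrite adj_sym; have /andP[] := fc _ (clP x xr).
  - by move=> wS _ /(only w wS) ->; have /andP[] := fc _ (clP x xr).
  exact: hom.
have [|S [Phi [cS _ inj cls hom]]] := ext #|T|.-1; first by rewrite prednK.
have ST v : v \in S.
  suff -> : S = setT by rewrite inE.
  by apply/eqP; rewrite eqEcard subsetT cardsT cS prednK ?leqnn.
apply: tileable_perfect.
have -> : [set: G] = \bigcup_(x in cl r) [set Phi x v | v : T].
  apply/esym/setP=> z; rewrite inE; apply/bigcupP.
  have : z \in (Phi^~ (p z)) @: cl r.
    suff -> : (Phi^~ (p z)) @: cl r = cl (p z) by rewrite inE.
    apply/eqP; rewrite eqEcard card_in_imset ?pN ?leqnn ?andbT; last exact: inj.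
    by apply/subsetP=> _ /imsetP[x xr ->]; rewrite inE cls.
  by case/imsetP=> x xr ->; exists x => //; apply: imset_f.
apply: tileable_bigcup => [x xr|x y xr yr xy].
  apply: tileable_tile; exists [ffun v => Phi x v]; last first.
    by apply: eq_imset => v; rewrite ffunE.
  split=> [u v|u v uv]; rewrite !ffunE; last exact: hom.
  by move=> e; rewrite -(cls x u xr (ST u)) e cls.
apply/pred0P=> z /=; apply/negP => /andP[/imsetP[u _ ->] /imsetP[v _ e]].
have uv : u = v by rewrite -(cls x u xr (ST u)) e cls.
rewrite -uv in e; move/eqP: xy; apply; exact: (inj u (ST u)) e.
Qed.

(** * Sparse random graphs *)

(** Independence of coordinates in counting form: all [F e] with [e] in [E0] fall into [Y] with
    probability [(#|Y| / #|C|) ^ #|E0|]. *)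
Lemma card_ffun_in (E C : finType) (E0 : {set E}) (Y : {set C}) :
  #|[set F : {ffun E -> C} | [forall e in E0, F e \in Y]]| * #|C| ^ #|E0|
  = #|Y| ^ #|E0| * #|C| ^ #|E|.
Proof.
have -> : #|[set F : {ffun E -> C} | [forall e in E0, F e \in Y]]| =
    \sum_(F : {ffun E -> C}) \prod_e (if e \in E0 then (F e \in Y : nat) else 1).
  rewrite -sum1dep_card big_mkcond; apply: eq_bigr => F _.
  case: forall_inP => [h|/forall_inP]; last rewrite negb_forall_in => /exists_inP[e eE FY].
    by rewrite big1 // => e _; case: ifP => // /h ->.
  by rewrite (bigD1 e) //= eE (negPf FY).
rewrite -(bigA_distr_bigA (fun e c => if e \in E0 then (c \in Y : nat) else 1)) /=.
have -> : \prod_e \sum_c (if e \in E0 then (c \in Y : nat) else 1) =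
    \prod_e (if e \in E0 then #|Y| else #|C|).
  apply: eq_bigr => e _; case: ifP => _; last by rewrite sum1_card.
  by rewrite -sum1_card [RHS]big_mkcond; apply: eq_bigr => c _; case: (c \in Y).
rewrite (bigID (mem E0)) /=.
have -> : \prod_(i in E0) (if i \in E0 then #|Y| else #|C|) = #|Y| ^ #|E0|.
  by rewrite -prod_nat_const; apply: eq_bigr => e ->.
have -> : \prod_(i | i \notin E0) (if i \in E0 then #|Y| else #|C|) = #|C| ^ #|~: E0|.
  rewrite -prod_nat_const; apply: eq_big => [i|i /negPf->//].
  by rewrite in_setC.
by rewrite -mulnA -expnD addnC cardsC.
Qed.

Section RandomGraph.
(* A uniformly random [F : model] is a binomial random graph with edge
   probability [1 / q.+1], coordinates [(x, y)] with [y < x] being ignored. *)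
Variables (n q c g : nat).
Local Notation E := ('I_n * 'I_n)%type.
Local Notation model := {ffun E -> 'I_q.+1}.

Definition sorted_pair (x y : 'I_n) : E := if x <= y then (x, y) else (y, x).

Lemma sorted_pairC x y : sorted_pair x y = sorted_pair y x.
Proof.
rewrite /sorted_pair; case: ltngtP => // e.
by congr (_, _); apply/val_inj.
Qed.

Lemma sorted_pair_eq x y z w : sorted_pair x y = sorted_pair z w ->
  (x = z /\ y = w) \/ (x = w /\ y = z).
Proof.
by rewrite /sorted_pair; case: ifP => _; case: ifP => _ [-> ->]; [left|right|right|left].
Qed.

Definition model_adj (F : model) : rel 'I_n :=
  fun x y => (x != y) && (F (sorted_pair x y) == ord0).

Lemma model_adj_sym F : symmetric (model_adj F).
Proof. by move=> x y; rewrite /model_adj eq_sym sorted_pairC. Qed.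

Lemma model_adj_irrefl F : irreflexive (model_adj F).
Proof. by move=> x; rewrite /model_adj eqxx. Qed.

(** Tuples carry a starting point and a direction, so a cycle of length [l] counts [2 * l] times;
    this only affects constants. *)
Definition short_cycles (F : model) : nat :=
  \sum_(l < g.+1 | 2 < l) #|[set x : l.-tuple 'I_n | uniq x && cycle (model_adj F) x]|.

Definition adjacent_pairs (F : model) : nat := #|[set e : E | model_adj F e.1 e.2]|.

Definition model_hole (s : nat) (F : model) : bool :=
  [exists AB : {set 'I_n} * {set 'I_n}, [&& [disjoint AB.1 & AB.2], #|AB.1| == s,
    #|AB.2| == s & [forall x in AB.1, forall y in AB.2, ~~ model_adj F x y]]].

Local Notation total := (q.+1 ^ #|{: E}|).

Lemma card_edges_in (E0 : {set E}) :
  #|[set F : model | [forall e in E0, F e == ord0]]| * q.+1 ^ #|E0| = total.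
Proof.
have := card_ffun_in E0 [set @ord0 q]; rewrite cards1 exp1n mul1n card_ord => <-.
by congr (#|(_ : {set _})| * _); apply/setP=> F; rewrite !inE; apply: eq_forallb_in => e _; rewrite inE.
Qed.

Hypothesis ncq : n <= c * q.+1.

Lemma sum_short_cycles :
  \sum_F short_cycles F <= (\sum_(l < g.+1) c ^ l) * total.
Proof.
rewrite /short_cycles exchange_big big_distrl /=.
rewrite [X in _ <= X](bigID (fun l : 'I_g.+1 => 2 < l)) /=.
apply: leq_trans (leq_addr _ _); apply: leq_sum => l l3.
have e : \sum_(F : model) #|[set x : l.-tuple 'I_n | uniq x && cycle (model_adj F) x]| =
    \sum_(x : l.-tuple 'I_n) #|[set F | uniq x && cycle (model_adj F) x]|.
  under eq_bigr do rewrite -sum1dep_card big_mkcond.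
  under [RHS]eq_bigr do rewrite -sum1dep_card big_mkcond.
  by rewrite exchange_big.
rewrite e.
apply: leq_trans (_ : \sum_(x : l.-tuple 'I_n) total %/ q.+1 ^ l <= _).
  apply: leq_sum => x _; have [ux|nux] := boolP (uniq x); last first.
    by rewrite (_ : [set F | _] = set0) ?cards0 //; apply/setP=> F; rewrite !inE.
  pose x0 := tnth x (Ordinal (ltnW (ltnW l3))).
  pose nx (i : 'I_l) := nth x0 x (i.+1 %% l).
  pose ed (i : 'I_l) := sorted_pair (nth x0 x i) (nx i).
  have l0 : 0 < l by apply: ltnW (ltnW l3).
  (* The [l] edges of the cycle are distinct coordinates: coincidence in reverse order would give
     [2 = 0] modulo [l], excluded by [2 < l]. *)
  have ed_inj : injective ed.
    move=> i j /sorted_pair_eq[[/eqP]|[/eqP e1 /eqP e2]].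
      by rewrite nth_uniq ?size_tuple // => /eqP e1 _; apply/val_inj.
    move: e1 e2; rewrite /nx !nth_uniq ?size_tuple ?ltn_mod // => /eqP -> /eqP.
    rewrite -addn1 modnDml addn1 => e2.
    have : j + 2 == j %[mod l] by rewrite addn2 e2 modn_small.
    by rewrite -{2}[j : nat]addn0 eqn_modDl mod0n modn_small.
  rewrite leq_divRL ?expn_gt0 //.
  rewrite -(card_edges_in [set ed i | i : 'I_l]) card_imset // card_ord leq_mul2r.
  apply/orP; right; apply/subset_leq_card/subsetP=> F; rewrite !inE /= => cF.
  apply/forall_inP=> _ /imsetP[i _ ->].
  have := cycle_nth x0 cF; rewrite size_tuple => /(_ i (ltn_ord i)).
  by rewrite /model_adj => /andP[].
rewrite sum_nat_const card_tuple card_ord.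
apply: leq_trans (_ : (c * q.+1) ^ l * (total %/ q.+1 ^ l) <= _).
  by rewrite leq_mul // leq_exp2r //; apply: ltnW (ltnW l3).
rewrite expnMn -mulnA leq_mul // mulnC; exact: leq_trunc_div.
Qed.

Lemma sum_adjacent_pairs : \sum_F adjacent_pairs F <= n * c * total.
Proof.
have -> : \sum_F adjacent_pairs F = \sum_(e : E) #|[set F : model | model_adj F e.1 e.2]|.
  rewrite /adjacent_pairs; under eq_bigr do rewrite -sum1dep_card big_mkcond.
  under [RHS]eq_bigr do rewrite -sum1dep_card big_mkcond.
  by rewrite exchange_big.
apply: leq_trans (_ : \sum_(e : E) total %/ q.+1 <= _).
  apply: leq_sum => e _; rewrite leq_divRL //.
  rewrite -(card_edges_in [set sorted_pair e.1 e.2]) cards1 expn1 leq_mul //.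
  apply/subset_leq_card/subsetP=> F; rewrite !inE => /andP[_ Fe].
  by apply/forall_inP => e'; rewrite inE => /eqP->.
rewrite sum_nat_const -mulnA.
rewrite card_prod card_ord -mulnA leq_mul //.
apply: leq_trans (leq_mul ncq (leqnn _)) _; rewrite -mulnA leq_mul // mulnC.
exact: leq_trunc_div.
Qed.

(** Union bound over at most [4 ^ n] pairs of sets; for each pair [s * s] distinct coordinates must
    avoid [ord0]. *)
Lemma card_holes s :
  #|[set F | model_hole s F]| * q.+1 ^ (s * s) <= 4 ^ n * q ^ (s * s) * total.
Proof.
pose H (AB : {set 'I_n} * {set 'I_n}) := [set F : model | [&& [disjoint AB.1 & AB.2], #|AB.1| == s,
    #|AB.2| == s & [forall x in AB.1, forall y in AB.2, ~~ model_adj F x y]]].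
have : #|[set F | model_hole s F]| <= \sum_AB #|H AB|.
  apply: leq_trans (_ : #|\bigcup_AB H AB| <= _).
    apply/subset_leq_card/subsetP=> F; rewrite inE => /existsP[AB hAB].
    by apply/bigcupP; exists AB => //; rewrite inE.
  elim/big_ind2: _ => [|A a B b le1 le2|//]; first by rewrite cards0.
  by apply: leq_trans (leq_card_setU _ _) _; apply: leq_add.
move=> le; apply: leq_trans (leq_mul le (leqnn _)) _.
rewrite big_distrl /=.
apply: leq_trans (_ : \sum_(AB : {set 'I_n} * {set 'I_n}) q ^ (s * s) * total <= _); last first.
  rewrite sum_nat_const card_prod -cardsT -powersetT card_powerset cardsT card_ord.
  by rewrite -expnMn mulnA.
apply: leq_sum => -[A B] _.
have [/and3P[dAB /eqP cA /eqP cB]|/negPf nh] := boolP [&& [disjoint A & B], #|A| == s & #|B| == s];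
  last first.
  rewrite (_ : H _ = set0) ?cards0 //; apply/setP=> F; rewrite !inE /=.
  by rewrite !andbA in nh *; rewrite nh.
pose E0 := [set sorted_pair e.1 e.2 | e in setX A B].
have cE0 : #|E0| = s * s.
  rewrite card_in_imset ?cardsX ?cA ?cB //.
  move=> [a b] [a' b']; rewrite !inE /= => /andP[aA bB] /andP[a'A b'B].
  move=> /sorted_pair_eq[[-> ->]//|[e _]].
  by have := disjointFr dAB aA; rewrite e b'B.
have := card_ffun_in E0 [set~ @ord0 q]; rewrite cardsC1 card_ord cE0 => <-.
rewrite leq_mul //; apply/subset_leq_card/subsetP=> F; rewrite !inE /=.
move=> /and4P[_ _ _ /forall_inP nA]; apply/forall_inP => _ /imsetP[[a b] ab ->] /=.
move: ab; rewrite inE /= => /andP[aA bB]; rewrite !inE.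
have /forall_inP/(_ b bB) := nA a aA; rewrite /model_adj negb_and negbK => /orP[/eqP e|//].
by have := disjointFr dAB aA; rewrite e bB.
Qed.

(** One weighted first moment for three properties: a hole weighs [n * C.+1], a short cycle [n], an
    adjacent pair [1]. A bad [F] has weight at least [n * C.+1], whereas the mean is below
    [n + n * (\sum_l c ^ l) + n * c], which is the same number. *)
Lemma exists_model (s : nat) : 0 < n ->
  (c + \sum_(l < g.+1) c ^ l).+1 * 4 ^ n * q ^ (s * s) < q.+1 ^ (s * s) ->
  exists F : model, [/\ ~~ model_hole s F,
    short_cycles F <= c + \sum_(l < g.+1) c ^ l &
    adjacent_pairs F <= n * (c + \sum_(l < g.+1) c ^ l).+1].
Proof.
move=> n0 lt; set C := c + _ in lt *; apply: contrapT => nex.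
have cM : #|{: model}| = total by rewrite card_ffun card_ord.
have big : n * C.+1 * total <= \sum_(F : model)
    (n * C.+1 * model_hole s F + n * short_cycles F + adjacent_pairs F).
  rewrite -cM mulnC -sum_nat_const; apply: leq_sum => F _.
  rewrite leqNgt; apply/negP => ltF; apply: nex; exists F; split.
  - apply/negP => h; move: ltF; rewrite h muln1 -addnA.
    by rewrite ltnNge leq_addr.
  - rewrite leqNgt; apply/negP => h; move: ltF; rewrite ltnNge => /negP; apply.
    by apply: leq_trans (leq_addr _ _); apply: leq_trans (leq_addl _ _); rewrite leq_mul2l h orbT.
  - by apply: leq_trans (ltnW ltF); apply: leq_addl.
have sh : \sum_(F : model) n * C.+1 * model_hole s F = n * C.+1 * #|[set F | model_hole s F]|.
  by rewrite -big_distrr /= -sum1dep_card [in RHS]big_mkcond; congr (_ * _);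
    apply: eq_bigr => F _; case: model_hole.
move: big; rewrite !big_split /= sh -big_distrr /= => big.
have q0 : 0 < q.+1 ^ (s * s) by rewrite expn_gt0.
have t0 : 0 < total by rewrite expn_gt0.
have h1 := card_holes s; have h2 := sum_short_cycles; have h3 := sum_adjacent_pairs.
have h4 : n * C.+1 * #|[set F | model_hole s F]| < n * total.
  rewrite -mulnA ltn_pmul2l // -(ltn_pmul2r q0) -mulnA.
  apply: leq_ltn_trans (leq_mul (leqnn C.+1) h1) _.
  by rewrite !mulnA [total * _]mulnC ltn_pmul2r.
have h5 := leq_mul (leqnn n) h2.
have : n * C.+1 * total < n * C.+1 * total.
  apply: leq_ltn_trans big _.
  have -> : n * C.+1 * total = n * total + n * ((\sum_(l < g.+1) c ^ l) * total) + n * c * total.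
    by rewrite /C; clear; lia.
  by rewrite -addSn leq_add // -addSn leq_add.
by rewrite ltnn.
Qed.

End RandomGraph.

(** The two leading terms of the binomial expansion of [(1 + q) ^ q.+1] already suffice. *)
Lemma double_expn_pred q : 2 * q ^ q.+1 <= q.+1 ^ q.+1.
Proof.
have := leq_addr (\sum_(i < q) 'C(q.+1, i) * (1 ^ (q.+1 - i) * q ^ i)) (q.+1 * q ^ q + q ^ q.+1).
have := expnDn 1 q q.+1; rewrite add1n => ->.
rewrite !big_ord_recr /= !exp1n !mul1n binn mul1n binSn.
by rewrite expnS; clear; lia.
Qed.

(** The integer substitute for [1 - x <= exp (- x)]: the power [N] of [1 - 1 / q.+1] is at most
    [2 ^ - w]. *)
Lemma expn_pred_bound q w N : q.+1 * w <= N -> 2 ^ w * q ^ N <= q.+1 ^ N.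
Proof.
move=> le.
have h : 2 ^ w * q ^ (q.+1 * w) <= q.+1 ^ (q.+1 * w).
  rewrite 2!expnM -expnMn; case: (w) => // v.
  by rewrite leq_exp2r // double_expn_pred.
have h' : q ^ (N - q.+1 * w) <= q.+1 ^ (N - q.+1 * w).
  by case: (N - _) => // v; rewrite leq_exp2r.
by have := leq_mul h h'; rewrite -mulnA -!expnD subnKC.
Qed.

Lemma sparse_graph (r g : nat) : 0 < r ->
  exists D n0, forall n, n0 <= n -> exists e : rel 'I_n,
  [/\ symmetric e, irreflexive e,
      forall A B : {set 'I_n}, [disjoint A & B] -> n <= r * #|A| -> n <= r * #|B| ->
        exists x y, [/\ x \in A, y \in B & e x y],
      forall s : seq 'I_n, 2 < size s <= g -> ~~ ucycleb e s &
      forall x, #|[set y | e x y]| <= D].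
Proof.
move=> r0; pose c := 96 * r ^ 2; pose C := c + \sum_(l < g.+1) c ^ l.
have c0 : 0 < c by rewrite muln_gt0 expn_gt0 r0.
exists (4 * r * C.+1), (4 * r * C.+1) => n nbig.
have nC : C.+1 <= n by apply: leq_trans nbig; rewrite leq_pmull // muln_gt0 r0.
have n0 : 0 < n by apply: leq_trans nC.
have cC : c <= C by rewrite leq_addr.
have nr : 4 * r <= n by apply: leq_trans nbig; rewrite leq_pmulr.
pose q := n %/ c; pose s := n %/ (2 * r).
have ncq : n <= c * q.+1 by rewrite mulnC; apply/ltnW/ltn_ceil.
have r20 : 0 < 2 * r by rewrite muln_gt0 r0.
have sn : n <= 4 * r * s.
  have := ltn_ceil n r20; rewrite -/s; move: nr; rewrite mulSn; clear; lia.
(* Here [96 = 6 * 16] in [c] is used: [c * q.+1 <= 2 * n] and [2 * n + C.+1 <= 3 * n] multiply to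
   [6 * n ^ 2], and [n <= 4 * r * s] gives [n ^ 2 <= 16 * r ^ 2 * s ^ 2]. *)
have lt : C.+1 * 4 ^ n * q ^ (s * s) < q.+1 ^ (s * s).
  have le : q.+1 * (2 * n + C.+1) <= s * s.
    rewrite -(leq_pmul2l c0).
    have h1 : c * q.+1 <= 2 * n.
      have := leq_trunc_div n c; rewrite -/q mulnS mulnC; move: cC nC; clear; lia.
    have h2 : 2 * n + C.+1 <= 3 * n by move: nC; clear; lia.
    have h3 := leq_mul sn sn; have h4 := leq_mul h1 h2.
    by move: h3 h4; rewrite /c !expnS expn0; clear; lia.
  apply: leq_trans (expn_pred_bound le).
  have q0 : 0 < q by rewrite divn_gt0 // (leq_trans cC (ltnW nC)).
  rewrite ltn_pmul2r ?expn_gt0 ?q0 // expnD expnM mulnC ltn_pmul2l ?expn_gt0 //.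
  exact: ltn_expl.
have [F [nh sc ap]] := exists_model ncq n0 lt.
pose v0 := Ordinal n0.
pose Z1 : {set 'I_n} := \bigcup_(l < g.+1 | 2 < l)
  [set nth v0 x 0 | x : l.-tuple 'I_n & uniq x && cycle (model_adj F) x].
pose Z2 := [set x | 4 * r * C.+1 < #|[set y | model_adj F x y]| ].
have cZ1 : #|Z1| <= C.
  apply: leq_trans sc; rewrite /Z1 /short_cycles.
  elim/big_ind2: _ => [|A a B b le1 le2|l _]; first by rewrite cards0.
    by apply: leq_trans (leq_card_setU _ _) _; apply: leq_add.
  by apply: leq_trans (leq_imset_card _ _) _; apply/subset_leq_card/subsetP=> x; rewrite !inE.
have cZ2 : 4 * r * #|Z2| <= n.
  rewrite -(leq_pmul2l (_ : 0 < C.+1)) // [X in _ <= X]mulnC.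
  apply: leq_trans ap.
  have -> : adjacent_pairs F = \sum_(x : 'I_n) #|[set y | model_adj F x y]|.
    rewrite /adjacent_pairs -sum1dep_card.
    under [RHS]eq_bigr do rewrite -sum1dep_card.
    by rewrite pair_big_dep.
  rewrite (bigID (mem Z2)) /=; apply: leq_trans (leq_addr _ _).
  apply: leq_trans (_ : \sum_(x in Z2) 4 * r * C.+1 <= _).
    by rewrite sum_nat_const; move: (C) #|Z2| => a b; clear; lia.
  by apply: leq_sum => x; rewrite inE => /ltnW.
(* The vertices of [Z] become isolated instead of being removed, so the order stays [n]. As
   [2 * r * #|Z| <= n], a set of [n / r] vertices keeps [s = n %/ (2 * r)] outside [Z]. *)
have [Z ZE] : exists Z, Z = Z1 :|: Z2 by eexists.
exists (fun x y => [&& model_adj F x y, x \notin Z & y \notin Z]); split.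
- by move=> x y; rewrite model_adj_sym; congr (_ && _); rewrite andbC.
- by move=> x; rewrite model_adj_irrefl.
- have cZ : 2 * r * #|Z| <= n.
    have : #|Z| <= #|Z1| + #|Z2| by rewrite ZE leq_card_setU.
    move=> /(leq_mul (leqnn (4 * r))); have := leq_mul (leqnn (4 * r)) cZ1.
    by move: cZ2 nbig; clear; rewrite mulnS; lia.
  have sub (A : {set 'I_n}) : n <= r * #|A| -> exists2 B : {set 'I_n}, B \subset A :\: Z & #|B| = s.
    move=> nA; apply: subset_of_card; rewrite -(leq_pmul2l r20).
    have h : #|A| <= #|A :\: Z| + #|Z|.
      by rewrite -(cardsID Z A) addnC leq_add2l subset_leq_card ?subsetIr.
    have := leq_trunc_div n (2 * r); rewrite -/s mulnC.
    by have := leq_mul (leqnn r) h; move: nA cZ; clear; lia.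
  move=> A B dAB /sub[A' sA cA] /sub[B' sB cB].
  have dAB' : [disjoint A' & B'].
    apply: disjointWl (fintype.subset_trans sA (subsetDl _ _)) _.
    exact: disjointWr (fintype.subset_trans sB (subsetDl _ _)) dAB.
  move: nh; rewrite negb_exists => /forallP/(_ (A', B')).
  rewrite /= dAB' cA cB eqxx /= negb_forall_in => /exists_inP[x xA].
  rewrite negb_forall_in => /exists_inP[y yB]; rewrite negbK => xy.
  have := subsetP sA x xA; have := subsetP sB y yB; rewrite !in_setD.
  by move=> /andP[yZ yB'] /andP[xZ xA']; exists x, y; rewrite xy xZ yZ.
- move=> l /andP[l2 lg]; apply/negP => /andP[cl ul].
  have cl' : cycle (model_adj F) l.
    by case: (l) cl => //= x l'; apply: sub_path => a b /andP[].
  have lt0 : 0 < size l by apply: ltnW (ltnW l2).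
  have := cycle_nth v0 cl lt0 => /and3P[_ /negP nZ _]; apply: nZ.
  rewrite ZE in_setU; apply/orP; left; apply/bigcupP.
  have lg' : size l < g.+1 by rewrite ltnS.
  exists (Ordinal lg') => //; apply/imsetP; exists (in_tuple l) => //.
  by rewrite inE ul.
move=> x; have [xZ|xZ] := boolP (x \in Z).
  by rewrite eq_card0 // => y; rewrite inE /= andbF.
move: xZ; rewrite ZE in_setU negb_or => /andP[_]; rewrite inE -leqNgt => le.
apply: leq_trans le; apply/subset_leq_card/subsetP=> y; rewrite !inE.
by case/andP.
Qed.

(** * Graphs without perfect tilings *)

Lemma ord2P (i : 'I_2) : i = ord0 \/ i = ord_max.
Proof. by case: i => [[|[|//]] lti]; [left|right]; apply/val_inj. Qed.

Lemma is_hole2 (G : sgraph) (s : nat) (U : 'I_2 -> {set G}) :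
  #|U ord0| = s -> #|U ord_max| = s -> [disjoint U ord0 & U ord_max] ->
  (forall x y, x \in U ord0 -> y \in U ord_max -> ~~ adj x y) -> is_hole s U.
Proof.
move=> c0 c1 d01 nadj.
split.
- by move=> i; case: (ord2P i) => ->.
- move=> i j; case: (ord2P i) => ->; case: (ord2P j) => -> //.
  by rewrite disjoint_sym.
case=> f [[_ fa] fU]; have := nadj _ _ (fU ord0) (fU ord_max).
by rewrite fa.
Qed.

Lemma joined_of_alpha_star (G : sgraph) (s : nat) :
  alpha_star 2 G < s -> joined G s.
Proof.
move=> lt A B dAB sA sB; apply: contrapT => nex.
have [A' A'A cA] := subset_of_card sA; have [B' B'B cB] := subset_of_card sB.
have sG : s < #|G|.+1 by rewrite ltnS -cA max_card.
move: lt; rewrite ltnNge => /negP; apply.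
apply: (bigmax_sup (Ordinal sG)) => //; apply/asboolP.
exists (fun i => if i == ord0 then A' else B'); apply: is_hole2 => //=.
  by apply: disjointWl A'A _; apply: disjointWr B'B _.
move=> x y xA yB; apply/negP => xy; apply: nex; exists x, y.
by split; rewrite ?(subsetP A'A) ?(subsetP B'B).
Qed.

Lemma alpha_star_le (G : sgraph) (r : nat) : 0 < r ->
  (forall A B : {set G}, [disjoint A & B] -> 0 < #|A| -> 0 < #|B| ->
     #|G| <= r * #|A| -> #|G| <= r * #|B| ->
     exists x y, [/\ x \in A, y \in B & adj x y]) ->
  r * alpha_star 2 G <= #|G|.
Proof.
move=> r0 H; rewrite mulnC -leq_divRL //.
apply/bigmax_leqP => -[s sG] /= /asboolP[U [cU dU nU]].
rewrite leq_divRL //; rewrite leqNgt mulnC; apply/negP => lt.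
have s0 : 0 < s by case: s {sG cU} lt => //; rewrite muln0.
have [|||||x [y [xU yU xy]]] := H (U ord0) (U ord_max).
- exact: dU.
- by rewrite cU.
- by rewrite cU.
- by rewrite cU ltnW.
- by rewrite cU ltnW.
apply: nU; pose f := [ffun i : complete_graph 2 => if i == ord0 then x else y].
have f0 : f ord0 = x by rewrite ffunE.
have f1 : f ord_max = y by rewrite ffunE.
have nxy : x != y by apply: contraTneq xy => ->; rewrite adj_irrefl.
exists f; split; last by move=> i; case: (ord2P i) => ->; rewrite ?f0 ?f1.
split=> i j; case: (ord2P i) => ->; case: (ord2P j) => ->; rewrite ?f0 ?f1 //.
- by move=> e; rewrite e eqxx in nxy.
- by move=> e; rewrite e eqxx in nxy.
- by move=> _; rewrite adj_sym.
Qed.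

Lemma min_degree_ge (G : sgraph) (a : nat) :
  a <= #|G| -> (forall x : G, a <= degree x) -> a <= min_degree G.
Proof.
move=> aG ad; rewrite /min_degree; elim/big_ind: _ => // x y ax ay.
by rewrite leq_min ax.
Qed.

Lemma min_degree_le (G : sgraph) (x : G) : min_degree G <= degree x.
Proof.
rewrite /min_degree; have : x \in index_enum G by rewrite mem_index_enum.
elim: (index_enum G) => //= y s IH; rewrite big_cons inE => /orP[/eqP<-|/IH].
  exact: geq_minl.
exact: leq_trans (geq_minr _ _).
Qed.

Lemma degreeE (G : sgraph) (x : G) : degree x = #|nbrs x|.
Proof. by apply: eq_card => y; rewrite !inE. Qed.

Lemma gamma_le (F : sgraph) (S : {set F}) :
  acyclic (del_vertices S) -> gamma F <= #|S|.
Proof.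
move=> aS; rewrite /gamma; have : S \in index_enum {set F} by rewrite mem_index_enum.
elim: (index_enum _) => //= A s IH; rewrite big_cons inE => /orP[/eqP<-|/IH h].
  by rewrite asboolT // geq_minl.
by case: ifP => // _; apply: leq_trans (geq_minr _ _) h.
Qed.

Lemma gamma_le_card (F : sgraph) : gamma F <= #|F|.
Proof.
rewrite -cardsT; apply: gamma_le => c c3 _.
case: c c3 => // x c _; by have := valP x; rewrite inE.
Qed.

Lemma perfect_tiling_count (F G : sgraph) (T : {set {ffun F -> G}}) (A : {set G}) :
  is_tiling T -> (forall v : G, exists2 f, f \in T & v \in codom f) ->
  #|A| = \sum_(f in T) #|[set x | f x \in A]|.
Proof.
move=> [cT dT] cov.
pose P := [set p : {ffun F -> G} * F | (p.1 \in T) && (p.1 p.2 \in A)].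
have -> : \sum_(f in T) #|[set x | f x \in A]| = #|P|.
  rewrite -sum1dep_card; under eq_bigr do rewrite -sum1dep_card.
  by rewrite pair_big_dep.
rewrite -(card_in_imset (_ : {in P &, injective (fun p : {ffun F -> G} * F => p.1 p.2)})).
  congr #|(_ : {set _})|; apply/setP=> v; apply/idP/imsetP => [vA|[p + ->]]; last first.
    by rewrite inE => /andP[].
  have [f fT /codomP[x e]] := cov v; exists (f, x) => //.
  by rewrite inE /= fT -e.
move=> [f x] [h y]; rewrite !inE /= => /andP[fT _] /andP[hT _] e.
have [fh|/eqP fh] := f =P h; last first.
  have := disjointFr (dT f h fT hT fh) (codom_f f x).
  by rewrite e codom_f.
by rewrite fh in e *; have [inj _] := cT h hT; rewrite (inj _ _ e).
Qed.

Lemma gamma_construction (F : sgraph) (r : nat) : 0 < r ->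
  exists n0, forall n a, n0 <= n -> a * #|F| < gamma F * n ->
  exists G : sgraph, [/\ #|G| = n, a <= min_degree G,
    r * alpha_star 2 G <= n & ~ has_perfect_tiling F G].
Proof.
move=> r0; have [D [n0 Hn]] := sparse_graph #|F| r0.
exists n0 => n a nn aF; have [e [es ei ej ec _]] := Hn n nn.
have an : a < n.
  rewrite ltnNge; apply/negP => na; move: aF; rewrite ltnNge => /negP; apply.
  by rewrite mulnC leq_mul // gamma_le_card.
(* The first [a] vertices are joined to everything; a copy of [F] leaves a
   forest in the sparse rest, so it uses [gamma F] of them. *)
pose ad : rel 'I_n := fun x y => (x != y) && [|| x < a, y < a | e x y].
have ads : symmetric ad by move=> x y; rewrite /ad eq_sym es orbCA.
have adi : irreflexive ad by move=> x; rewrite /ad eqxx.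
pose G := SGraph ads adi; pose A : {set G} := [set x : 'I_n | x < a].
have cA : #|A| = a.
  have -> : A = [set widen_ord (ltnW an) x | x : 'I_a].
    apply/setP=> x; rewrite inE; apply/idP/imsetP => [xa|[y _ ->]]; last exact: (ltn_ord y).
    by exists (Ordinal xa) => //; apply/val_inj.
  rewrite card_imset ?card_ord // => x y e1; apply/val_inj.
  exact: (congr1 val e1).
have cG : #|G| = n := card_ord n.
exists G; split=> //.
- apply: min_degree_ge => [|x]; first by rewrite cG ltnW.
  have [xa|xa] := boolP (x \in A).
    have -> : degree x = #|[set~ x]|.
      by apply: eq_card => y; rewrite !inE /= /ad; move: xa; rewrite inE => ->; rewrite andbT eq_sym.
    by rewrite cardsC1 cG; move: an; clear; lia.
  rewrite -cA; apply/subset_leq_card/subsetP=> y yA; rewrite inE /= /ad.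
  move: (yA); rewrite inE => ->; rewrite orbT andbT.
  by apply: contraNneq xa => ->.
- rewrite -[X in _ <= X]cG; apply: alpha_star_le => // U V dUV U0 V0 rU rV.
  have [/existsP[x /andP[xU xA]]|nU] := boolP [exists x, (x \in U) && (x \in A)].
    have /card_gt0P[y yV] := V0; exists x, y; split=> //=.
    rewrite /ad; move: xA; rewrite inE => ->; rewrite andbT.
    by apply: contraTneq yV => <-; rewrite (disjointFr dUV xU).
  rewrite cG in rU rV.
  have [x [y [xU yV xy]]] := ej U V dUV rU rV; exists x, y; split=> //=.
  rewrite /ad xy !orbT andbT.
  by apply: contraTneq yV => <-; rewrite (disjointFr dUV xU).
case=> T [tT cov].
have := perfect_tiling_count A tT cov; rewrite cA => eA.
have := perfect_tiling_count [set: G] tT cov; rewrite cardsT cG => eN.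
have : gamma F * n <= a * #|F|; last by rewrite leqNgt aF.
rewrite eN eA big_distrr big_distrl; apply: leq_sum => f fT.
have [fi fa] := tT.1 f fT.
have -> : [set x | f x \in [set: G]] = setT by apply/setP=> x; rewrite !inE.
rewrite cardsT leq_mul2r; apply/orP; right; apply: gamma_le => c c3 /andP[cc uc].
(* A cycle of [F] avoiding the preimage of [A] would map to a cycle of the sparse graph on at most
   [#|F|] vertices, the length up to which these are excluded. *)
have := ec (map (fun x => f (val x)) c); rewrite size_map c3 /=.
have -> : size c <= #|F|.
  have /card_uniqP : uniq (map val c) by rewrite map_inj_uniq //; apply: val_inj.
  by rewrite size_map => <-; apply: max_card.
move=> /(_ isT)/negP; apply; apply/andP; split; last first.
  by rewrite map_inj_uniq // => x y /fi/val_inj.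
rewrite cycle_map; apply: sub_cycle cc => x y /= xy.
have := fa _ _ xy; have := valP x; have := valP y.
rewrite !inE /= /ad => /negPf -> /negPf ->.
by case/andP.
Qed.

Lemma triangle_construction (r : nat) : 0 < r ->
  exists C n0, forall n, n0 <= n ->
  exists G : sgraph, [/\ #|G| = n, n <= 2 * (min_degree G + C),
    r * alpha_star 2 G <= n & ~ has_perfect_tiling (complete_graph 3) G].
Proof.
move=> r0; have r2 : 0 < 2 * r by rewrite muln_gt0.
(* Sets are cut down to their larger half on one side, hence [2 * r]; only the degree bound and the
   small holes matter, hence no restriction on cycles. *)
have [D [n0 Hn]] := sparse_graph 0 r2.
exists (D ^ 2 + 4), (n0 + 2 * r * (D ^ 2).+1 + 4) => n nn.
have [|e [es ei ej _ eD]] := Hn n.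
  by apply: leq_trans nn; rewrite -addnA leq_addr.
have nD : 2 * r * (D ^ 2).+1 <= n.
  by apply: leq_trans nn; rewrite addnAC leq_addl.
have n4 : 4 <= n by apply: leq_trans nn; rewrite leq_addl.
(* Of [n./2] and its successor at least one is not divisible by 3. *)
have [a [a1 a2 a3]] : exists a, [/\ n <= 2 * a + 2, 2 * a <= n + 2 & ~~ (3 %| a)].
  have [d3|d3] := boolP (3 %| n./2); last by exists n./2; split=> //; lia.
  by exists (n./2).+1; split; move: d3; clear; lia.
pose sd (x : 'I_n) := x < a.
pose X : rel 'I_n := fun x y => e x y && (sd x != sd y).
have Xs : symmetric X by move=> x y; rewrite /X es eq_sym.
(* Vertices on the same side are joined unless they have a common cross
   neighbour, so that no triangle meets both sides. *)
pose ad : rel 'I_n := fun x y => (x != y) &&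
  (if sd x == sd y then ~~ [exists z, X x z && X y z] else e x y).
have ads : symmetric ad.
  move=> x y; rewrite /ad eq_sym [sd x == _]eq_sym es; congr (_ && (if _ then _ else _)).
  by congr (~~ _); apply: eq_existsb => z; rewrite andbC.
have adi : irreflexive ad by move=> x; rewrite /ad eqxx.
pose G := SGraph ads adi.
have cG : #|G| = n := card_ord n.
have cA : #|[set x : G | sd x]| = a.
  have an : a <= n by lia.
  have -> : [set x : G | sd x] = [set widen_ord an x | x : 'I_a].
    apply/setP=> x; rewrite inE; apply/idP/imsetP => [xa|[y _ ->]]; last exact: (ltn_ord y).
    by exists (Ordinal xa) => //; apply/val_inj.
  rewrite card_imset ?card_ord // => x y e1; apply/val_inj.
  exact: (congr1 val e1).
pose N2 (x : 'I_n) := [set y | [exists z, X x z && X y z]].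
have cN2 x : #|N2 x| <= D ^ 2.
  have sub : N2 x \subset \bigcup_(z in [set z | e x z]) [set y | e z y].
    apply/subsetP=> y; rewrite inE => /existsP[z /andP[/andP[xz _] /andP[yz _]]].
    by apply/bigcupP; exists z; rewrite inE // es.
  apply: leq_trans (subset_leq_card sub) _.
  apply: leq_trans (_ : \sum_(z in [set z | e x z]) #|[set y | e z y]| <= _).
    elim/big_ind2: _ => [|B b B' b' le1 le2|//]; first by rewrite cards0.
    by apply: leq_trans (leq_card_setU _ _) _; apply: leq_add.
  apply: leq_trans (leq_sum _ (fun z _ => eD z)) _.
  by rewrite sum_nat_const leq_mul // eD.
have side_big b : n <= 2 * #|[set x : G | sd x == b]| + 2.
  have := cardsC [set x : G | sd x]; rewrite cA cG => cA'.
  have -> : [set x : G | sd x == b] = if b then [set x | sd x] else ~: [set x | sd x].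
    by apply/setP=> x; case: b; rewrite !inE ?eqb_id ?eqbF_neg.
  have ar x y z : x + y = z -> 2 * x <= z + 2 -> z <= 2 * y + 2 by clear; lia.
  by case: b => /=; [rewrite cA | apply: ar cA' a2].
exists G; split=> //.
- have d0 (x : G) : n <= 2 * (degree x + (D ^ 2 + 2)).
    have sub : [set y : G | sd y == sd x] \subset
        x |: (N2 x :|: [set y : G | adj x y]).
      apply/subsetP=> y; rewrite !in_setU !inE => /eqP e1.
      case: eqVneq => //= nyx; rewrite /ad e1 eqxx eq_sym nyx /=.
      by case: [exists z, X x z && X y z].
    have := subset_leq_card sub; rewrite cardsU1.
    have : #|N2 x :|: [set y : G | adj x y]| <= #|N2 x| + degree x.
      apply: leq_trans (leq_card_setU _ _) _; rewrite leq_add2l.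
      by rewrite degreeE; apply/subset_leq_card/subsetP=> y; rewrite !inE.
    have := cN2 x; have := side_big (sd x); case: (x \notin _) => /=; lia.
  have /(_ G (uphalf n - (D ^ 2 + 2))) := @min_degree_ge.
  have h1 : uphalf n - (D ^ 2 + 2) <= #|G| by rewrite cG; lia.
  move=> /(_ h1) h2.
  have : uphalf n - (D ^ 2 + 2) <= min_degree G.
    by apply: h2 => x; have := d0 x; lia.
  by lia.
- rewrite -[X in _ <= X]cG; apply: alpha_star_le => // U V dUV U0 V0 rU rV.
  have half (B : {set G}) : n <= r * #|B| -> exists b, n <= 2 * r * #|B :&: [set x : G | sd x == b]|.
    move=> nB; have cB : #|B :&: [set x : G | sd x == true]| + #|B :&: [set x : G | sd x == false]| = #|B|.
      rewrite -[RHS](cardsID [set x : G | sd x == true]); congr (_ + #|(_ : {set _})|).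
      by apply/setP=> x; rewrite !inE; case: (sd x); rewrite ?andbF ?andbT.
    have [le|/ltnW le] := leqP n (2 * r * #|B :&: [set x : G | sd x == true]|); first by exists true.
    by exists false; rewrite -cB in nB; nia.
  rewrite cG in rU rV; have [b nU] := half U rU; have [b' nV] := half V rV.
  have [ebb|nbb] := eqVneq b b'; last first.
    have [|x [y [xU yV xy]]] := ej _ _ _ nU nV.
      by apply: disjointWl (subsetIl _ _) _; apply: disjointWr (subsetIl _ _) dUV.
    move: xU yV; rewrite !inE => /andP[xU /eqP xb] /andP[yV /eqP yb].
    exists x, y; split=> //=; rewrite /ad xb yb (negPf nbb) xy andbT.
    by apply: contraTneq yV => <-; rewrite (disjointFr dUV xU).
  have n0' : 0 < n by lia.
  have /card_gt0P[x] : 0 < #|U :&: [set x : G | sd x == b]|.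
    by case: #|_| nU => //; rewrite muln0 leqNgt n0'.
  rewrite !inE => /andP[xU /eqP xb].
  (* At most [D ^ 2] vertices of the side are barred from being joined to [x], fewer than [V] has on
     that side. *)
  have [y yV yN] : exists2 y, y \in V :&: [set x : G | sd x == b'] & y \notin N2 x.
    apply/exists_inP; apply: contraT; rewrite negb_exists_in => /forall_inP h.
    have : #|V :&: [set x : G | sd x == b']| <= #|N2 x|.
      by apply/subset_leq_card/subsetP=> z /h; rewrite negbK.
    move=> /leq_trans/(_ (cN2 x)) le; have : n <= 2 * r * D ^ 2.
      by apply: leq_trans nV _; rewrite leq_mul.
    by move: nD; rewrite mulnS; lia.
  move: yV; rewrite !inE => /andP[yV /eqP yb].
  exists x, y; split=> //=; rewrite /ad xb yb ebb eqxx.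
  move: yN; rewrite inE => ->; rewrite andbT.
  by apply: contraTneq yV => <-; rewrite (disjointFr dUV xU).
case=> T [tT cov].
have := perfect_tiling_count [set x : G | sd x] tT cov; rewrite cA => eA.
move/negP: a3; apply; rewrite eA; apply: dvdn_sum => f fT.
have [_ fa] := tT.1 f fT.
(* With [f i] and [f l] on one side and [f j] on the other, [f j] is a common cross neighbour, which
   rules out the edge between [f i] and [f l]. *)
have same (i j l : 'I_3) : i != j -> j != l -> i != l ->
   sd (f i) != sd (f j) -> sd (f i) = sd (f l) -> False.
  move=> ij jl il sij sil.
  have := fa i j ij; have := fa l j; have := fa i l il => /=.
  rewrite /complete_adj eq_sym jl => h1 /(_ isT) h2 h3.
  move: h1 h2 h3; rewrite /ad -sil eqxx (negPf sij) => /andP[_ /negP h1] /andP[_ h2] /andP[_ h3].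
  by apply: h1; apply/existsP; exists (f j); rewrite /X -sil sij h2 h3.
have all_same (i j : 'I_3) : sd (f i) = sd (f j).
  have [//|sij] := eqVneq (sd (f i)) (sd (f j)); exfalso.
  have ij : i != j by apply: contraNneq sij => ->.
  have [l [il jl]] : exists l : 'I_3, i != l /\ j != l.
    have : 0 < #|~: [set i; j]|.
      by have := cardsC [set i; j]; rewrite card_ord cards2 ij; lia.
    by case/card_gt0P=> l; rewrite !inE negb_or ![l == _]eq_sym => /andP[]; exists l.
  have [e1|e1] := eqVneq (sd (f i)) (sd (f l)); first exact: (same i j l).
  apply: (same j i l) => //; [by rewrite eq_sym|by rewrite eq_sym|].
  by move: sij e1; case: (sd (f i)); case: (sd (f j)); case: (sd (f l)).
have -> : [set x | f x \in [set x : G | sd x]] = if sd (f ord0) then setT else set0.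
  apply/setP=> i; rewrite !inE (all_same i ord0).
  by case: (sd (f ord0)); rewrite inE.
by case: ifP => _; rewrite ?cards0 // cardsT card_ord.
Qed.

(** * Thresholds *)

Lemma linear_lt_expn2 (a b : nat) : exists s0, forall s, s0 <= s -> a * s + b < 2 ^ s.
Proof.
exists (2 * (2 * a + b).+2) => s le.
pose h := s %/ 2; have hs : s <= 2 * h + 1 by rewrite /h; lia.
have ha : 2 * a + b < h by rewrite /h; lia.
have h1 : h.+1 <= 2 ^ h by apply: ltn_expl.
have h2 : 2 ^ h * 2 ^ h <= 2 ^ s by rewrite -expnD leq_exp2l // /h; lia.
apply: leq_trans h2; apply: leq_trans (leq_mul h1 h1).
have h3 := leq_mul (leqnn a) hs; have h4 := leq_mul ha (leqnn h).
by move: h3 h4 ha; clear; lia.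
Qed.

(** The choice [d = 4 * #|T| * s] makes [(1 - 1 / (2 * #|T|)) ^ d] at most [2 ^ - (2 * s)]. One
    factor [2 ^ s] pays for the [s] required neighbours, the other for the union bound of size
    linear in [s]. *)
Lemma tree_threshold (T : sgraph) (q : nat) : is_tree T -> 0 < q ->
  exists2 c, 0 < c & exists s0, forall s, s0 <= s -> forall G : sgraph,
    #|G| = c * #|T| * s -> #|G| <= q * min_degree G -> alpha_star 2 G < s ->
    has_perfect_tiling T G.
Proof.
move=> tT q0; have T0 : 0 < #|T| by case: tT => [[]].
exists (q * 4 * #|T|); first by rewrite !muln_gt0 q0 T0.
have [s0 Hs] := linear_lt_expn2 (q * 4 * #|T| * #|T| * #|T|) 0.
exists s0.+1 => s ss G cG dG aG.
have sp : 0 < s by apply: leq_trans ss.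
apply: (@tree_perfect G T (q * 4 * #|T| * s) (4 * #|T| * s) s) => //.
- exact: joined_of_alpha_star.
- by rewrite cG; clear; lia.
- move=> v; rewrite -(leq_pmul2l q0).
  apply: leq_trans (_ : #|G| <= _); first by rewrite cG; clear; lia.
  by apply: leq_trans dG _; rewrite leq_mul2l -degreeE min_degree_le orbT.
have kk : 2 * #|T| = (2 * #|T|).-1.+1 by rewrite prednK // muln_gt0 T0.
have /expn_pred_bound : (2 * #|T|).-1.+1 * (2 * s) <= 4 * #|T| * s.
  by rewrite -kk; clear; lia.
rewrite -kk; apply: leq_trans.
rewrite ltn_pmul2r ?expn_gt0; last by rewrite -[_ < _]ltnS -kk; move: T0; clear; lia.
have := Hs s (ltnW ss); rewrite addn0 => lt.
have -> : 2 ^ (2 * s) = 2 ^ s * 2 ^ s by rewrite -expnD mul2n addnn.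
rewrite ltn_pmul2r ?expn_gt0 //; apply: leq_trans lt.
by rewrite ltnS cG; clear; lia.
Qed.

(** With [beta = 2 ^ L], the number of gadgets [Q = 16 * k ^ 2 * L] brings the rejected proportion
    down to [2 ^ - L], and [M] is exactly [2 * #|G| / beta]. Slot sizes are linear in [L] while the
    density of slots decays like [2 ^ - L], so a large [L] makes them fit. *)
Lemma cycle_threshold (k e : nat) : 3 < k -> 0 < e ->
  exists2 c, 0 < c & exists t0, forall t, t0 <= t -> forall G : sgraph,
    #|G| = c * k * t -> e.+1 * #|G| <= e * k * min_degree G ->
    alpha_star 2 G < t -> has_perfect_tiling (cycle_graph k) G.
Proof.
move=> k4 e0; have k0 : 0 < k by apply: leq_trans k4.
have [L HL] := linear_lt_expn2 (8 * e * k * (48 * k ^ 3)) (8 * e * k * (2 * k)).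
pose P := 384 * k ^ 3 * e.
have P0 : 0 < P by rewrite !muln_gt0 e0 ?expn_gt0 k0.
exists (2 ^ L * P); first by rewrite muln_gt0 expn_gt0 P0.
pose Q := 16 * k ^ 2 * L.
exists (3 * k * Q + 5 * k).+1 => t tt G cG dG aG.
have t0 : 0 < t by apply: leq_trans tt.
have L0 : 0 < 2 ^ L by rewrite expn_gt0.
have k2 : 0 < k ^ 2 by rewrite expn_gt0 k0.
have E (x : nat) : x <= 384 * k ^ 4 * e * t -> x <= #|G|.
  move=> h; apply: leq_trans h _; rewrite cG /P.
  have := leq_pmull (384 * k ^ 4 * e * t) L0; rewrite !expnS expn0; clear; lia.
have GB : 8 * k < 384 * k ^ 4 * e * t.
  have h1 : k <= k ^ 4 by rewrite -{1}[k]expn1 leq_pexp2l.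
  have h2 : k ^ 4 <= k ^ 4 * (e * t) by rewrite leq_pmulr // muln_gt0 e0.
  by move: h1 h2 k0; clear; lia.
apply: (@cycle_perfect G k e t (2 ^ L) Q (2 * (P * k) * t)) => //.
- exact: joined_of_alpha_star.
- by rewrite cG mulnAC dvdn_mull.
- exact/(leq_trans _ (E _ GB)).
- by move=> v; apply: leq_trans dG _; rewrite leq_mul2l -degreeE min_degree_le orbT.
- exact: E.
- apply: E; have := leq_pmulr (384 * k ^ 4 * t) e0; clear; lia.
- have h1 : k ^ 3 <= k ^ 4 by rewrite leq_pexp2l.
  have h2 : k ^ 4 * t * 2 ^ L <= k ^ 4 * t * 2 ^ L * e by rewrite leq_pmulr.
  have h3 := leq_mul h1 (leqnn (t * 2 ^ L)).
  by move: h2 h3; rewrite cG /P !expnS expn0; clear; lia.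
- have A0 : 0 < 16 * k ^ 2 by rewrite muln_gt0 k2.
  have := @expn_pred_bound (16 * k ^ 2).-1 L Q; rewrite prednK // => /(_ (leqnn _)).
  by rewrite mulnC.
- have := leq_mul (ltnW (HL L (leqnn L))) (leqnn (P * k * t)).
  by rewrite cG /Q !expnS expn0; clear; lia.
- have h1 : k ^ 2 * e <= k ^ 4 * e by rewrite leq_mul2r leq_pexp2l ?orbT.
  have := leq_mul h1 (leqnn t).
  by rewrite /P !expnS expn0; clear; lia.
by rewrite cG; clear; lia.
Qed.

From mathcomp Require Import all_order all_algebra all_classical all_reals lra.

Import Order.TTheory GRing.Theory Num.Theory.
Local Open Scope ring_scope.

(** * Passage from natural-number thresholds to the real parameter *)

Section RTT.
Variable R : realType.
Implicit Types (F G : sgraph) (c eta alpha : R).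

Lemma RTT_star_ge0 F : (0 < #|F|)%N -> 0 <= RTT_star R 2 F.
Proof. by move=> /(RTT_star_max R 2)[[]]. Qed.

(** [RTT_lower] provides graphs without a tiling for every [alpha] and all large multiples of
    [#|F|], so one [alpha] and arbitrarily large [n] contradict it at the midpoint of [c] and
    [RTT_star R 2 F]. *)
Lemma RTT_star_le F c : (0 < #|F|)%N -> 0 <= c ->
  (forall eta, c < eta -> exists2 alpha : R, 0 < alpha &
    forall n0 : nat, exists n : nat, [/\ (n0 <= n)%N, (#|F| %| n)%N &
      forall G, #|G| = n -> eta * n%:R <= (min_degree G)%:R ->
        (alpha_star 2 G)%:R <= alpha * n%:R -> has_perfect_tiling F G]) ->
  RTT_star R 2 F <= c.
Proof.
move=> F0 c0 H; rewrite leNgt; apply/negP => lt.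
have [[_ low] _] := RTT_star_max R 2 F0.
have [alpha al0 Hal] := H ((c + RTT_star R 2 F) / 2%:R) (midf_lt lt).1.
have [|n0 Hn0] := low ((c + RTT_star R 2 F) / 2%:R) alpha _ al0.
  by rewrite (midf_lt lt).2 (le_lt_trans c0 (midf_lt lt).1).
have [n [nn Fn Hn]] := Hal n0; have [G [cG dG aG]] := Hn0 n nn Fn.
by apply; apply: Hn.
Qed.

Lemma RTT_star_ge F c : (0 < #|F|)%N -> 0 <= c ->
  (forall eta alpha, 0 < eta < c -> 0 < alpha ->
    exists n0 : nat, forall n : nat, (n0 <= n)%N -> (#|F| %| n)%N ->
    exists G, [/\ #|G| = n, eta * n%:R <= (min_degree G)%:R,
      (alpha_star 2 G)%:R <= alpha * n%:R & ~ has_perfect_tiling F G]) ->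
  c <= RTT_star R 2 F.
Proof. by move=> F0 c0 H; have [_] := RTT_star_max R 2 F0; apply; split. Qed.

Lemma nat_gt_inv (x : R) : 0 < x -> exists2 q : nat, (0 < q)%N & 1 <= x * q%:R.
Proof.
move=> x0; exists (Num.bound x^-1).
  rewrite -(ltr_nat R); apply: le_lt_trans (archi_boundP _); by rewrite invr_ge0 ltW.
rewrite mulrC -ler_pdivrMr // mul1r; apply/ltW/archi_boundP.
by rewrite invr_ge0 ltW.
Qed.

Lemma half_scale_lt (a s : nat) : (0 < a)%N -> (0 < s)%N ->
  (2 * a)%:R^-1 * (a * s)%:R < s%:R :> R.
Proof.
move=> a0 s0; rewrite mulrC ltr_pdivrMr ?ltr0n ?muln_gt0 // -natrM ltr_nat.
by rewrite mulnCA [(s * a)%N]mulnC ltn_Pmull // muln_gt0 a0.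
Qed.

Lemma RTT_star_tree F : is_tree F -> RTT_star R 2 F = 0.
Proof.
move=> tF; have F0 : (0 < #|F|)%N by case: tF => [[]].
apply/eqP; rewrite eq_le RTT_star_ge0 // andbT; apply: RTT_star_le => // eta eta0.
have [q q0 etaq] := nat_gt_inv eta0.
have [c c0 [s0 Hs]] := tree_threshold tF q0.
have ck0 : (0 < c * #|F|)%N by rewrite muln_gt0 c0.
exists (2 * (c * #|F|))%:R^-1; first by rewrite invr_gt0 ltr0n muln_gt0.
move=> n0; pose s := (s0 + n0).+1.
exists (c * #|F| * s)%N; split.
- apply: leq_trans (leq_pmull s ck0); rewrite /s; lia.
- by rewrite mulnAC dvdn_mull.
move=> G cG dG aG; apply: (Hs s _ G cG); first by rewrite /s; lia.
  rewrite -(ler_nat R) cG [X in _ <= X]natrM; apply: le_trans (_ : q%:R * (eta * (c * #|F| * s)%:R) <= _).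
    by rewrite mulrA [q%:R * _]mulrC ler_peMl.
  by rewrite ler_pM2l ?ltr0n.
rewrite -(ltr_nat R); apply: le_lt_trans aG _; exact: half_scale_lt.
Qed.

Lemma RTT_star_cycle k : (3 < k)%N -> RTT_star R 2 (cycle_graph k) <= 1 / k%:R.
Proof.
move=> k4; have k0 : (0 < k)%N by apply: leq_trans k4.
have kR : 0 < k%:R :> R by rewrite ltr0n.
have cF : #|cycle_graph k| = k := card_ord k.
apply: RTT_star_le; rewrite ?cF ?divr_ge0 // => eta; rewrite ltr_pdivrMr // => lt.
(* This [e] satisfies [(e + 1) / (e * k) <= eta]. *)
have [|e e0 He] := @nat_gt_inv (eta * k%:R - 1); first by rewrite subr_gt0.
have [c c0 [t0 Ht]] := cycle_threshold k4 e0.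
have ck0 : (0 < c * k)%N by rewrite muln_gt0 c0.
exists (2 * (c * k))%:R^-1; first by rewrite invr_gt0 ltr0n muln_gt0.
move=> n0; pose t := (t0 + n0).+1.
exists (c * k * t)%N; split.
- apply: leq_trans (leq_pmull t ck0); rewrite /t; lia.
- by rewrite mulnAC dvdn_mull.
move=> G cG dG aG; apply: (Ht t _ G cG); first by rewrite /t; lia.
  rewrite -(ler_nat R) cG [X in X <= _]natrM [X in _ <= X]natrM [(e * k)%:R]natrM.
  apply: le_trans (_ : e%:R * k%:R * (eta * (c * k * t)%:R) <= _); last first.
    by rewrite ler_pM2l // -natrM ltr0n muln_gt0 e0.
  rewrite mulrA ler_wpM2r // -natr1.
  by move: He; rewrite mulrBl mul1r lerBrDl; nra.
rewrite -(ltr_nat R); apply: le_lt_trans aG _; exact: half_scale_lt.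
Qed.

Lemma RTT_star_gamma F : (0 < #|F|)%N -> (gamma F)%:R / #|F|%:R <= RTT_star R 2 F.
Proof.
move=> F0; have kR : 0 < #|F|%:R :> R by rewrite ltr0n.
apply: RTT_star_ge; rewrite ?divr_ge0 // => eta alpha /andP[eta0].
rewrite ltr_pdivlMr // => lt al0.
have [r r0 Hr] := nat_gt_inv al0.
have [n0 Hn] := gamma_construction F r0.
have lt' : 0 < (gamma F)%:R - eta * #|F|%:R by rewrite subr_gt0.
(* For [n >= n1] the gap between [gamma F * n] and [eta * n * #|F|] is at least [2 * #|F|], which
   absorbs rounding [eta * n] up to [a.+1]. *)
have [|n1 n10 Hn1] := @nat_gt_inv (((gamma F)%:R - eta * #|F|%:R) / (2 * #|F|)%:R).
  by rewrite divr_gt0 // ltr0n muln_gt0.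
exists (n0 + n1)%N => n nn _.
have nn1 : n1%:R <= n%:R :> R by rewrite ler_nat; apply: leq_trans nn; rewrite leq_addl.
pose a := Num.truncn (eta * n%:R).
have ea : eta * n%:R < a.+1%:R by apply: truncnS_gt.
have ae : a%:R <= eta * n%:R by rewrite truncn_le // mulr_ge0 // ltW.
have [||G [cG dG aG nG]] := Hn n a.+1.
- by apply: leq_trans nn; rewrite leq_addr.
- rewrite -(ltr_nat R) !natrM -natr1.
  have h1 : a%:R * #|F|%:R <= eta * n%:R * #|F|%:R by rewrite ler_pM2r.
  have h2 : ((gamma F)%:R - eta * #|F|%:R) * n1%:R <= ((gamma F)%:R - eta * #|F|%:R) * n%:R.
    by rewrite ler_pM2l.
  move: Hn1; rewrite mulrAC ler_pdivlMr ?ltr0n ?muln_gt0 // mul1r natrM.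
  by move: h1 h2 kR; clear; lra.
exists G; split=> //.
- by apply: le_trans (ltW ea) _; rewrite ler_nat.
apply: le_trans (_ : alpha * r%:R * (alpha_star 2 G)%:R <= _).
  by rewrite ler_peMl.
by rewrite -mulrA ler_pM2l // -natrM ler_nat.
Qed.

Lemma RTT_star_triangle : 1 / 2%:R <= RTT_star R 2 (complete_graph 3).
Proof.
have cF : #|complete_graph 3| = 3 := card_ord 3.
apply: RTT_star_ge; rewrite ?cF ?divr_ge0 // => eta alpha /andP[eta0].
rewrite ltr_pdivlMr // => lt al0.
have [r r0 Hr] := nat_gt_inv al0.
have [C [n0 Hn]] := triangle_construction r0.
have lt' : 0 < 1 - eta * 2%:R by rewrite subr_gt0.
have [n1 n10 Hn1] := nat_gt_inv lt'.
(* Then [(1 - 2 * eta) * n >= 2 * C], so the loss of [C] in the minimum degree still leaves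
   [eta * n]. *)
exists (n0 + 2 * C * n1)%N => n nn _.
have [|G [cG dG aG nG]] := Hn n; first by apply: leq_trans nn; rewrite leq_addr.
have nn1 : (2 * C * n1)%:R <= n%:R :> R by rewrite ler_nat; apply: leq_trans nn; rewrite leq_addl.
exists G; split=> //.
  move: dG; rewrite -(ler_nat R) natrM natrD => dG.
  rewrite !natrM in nn1.
  have h1 : (1 - eta * 2) * (2 * C%:R * n1%:R) <= (1 - eta * 2) * n%:R by rewrite ler_pM2l.
  have h2 : 2 * C%:R * 1 <= 2 * C%:R * ((1 - eta * 2) * n1%:R) by rewrite ler_wpM2l // mulr_ge0.
  by move: dG h1 h2; clear; lra.
apply: le_trans (_ : alpha * r%:R * (alpha_star 2 G)%:R <= _).
  by rewrite ler_peMl.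
by rewrite -mulrA ler_pM2l // -natrM ler_nat.
Qed.

End RTT.

Theorem theorem2 (R : realType) (k : nat) (hk : (3 <= k)%N) :
  [/\ forall T : sgraph, #|T| = k -> is_tree T -> RTT_star R 2 T = 0,
      forall F : sgraph, #|F| = k ->
        (gamma F)%:R / k%:R <= RTT_star R 2 F,
      (4 <= k)%N -> RTT_star R 2 (cycle_graph k) <= 1 / k%:R &
      1 / 2%:R <= RTT_star R 2 (complete_graph 3)].
Proof.
split.
- by move=> T _; apply: RTT_star_tree.
- by move=> F cF; rewrite -cF; apply: RTT_star_gamma; rewrite cF (leq_trans _ hk).
- exact: RTT_star_cycle.
- exact: RTT_star_triangle.
Qed.
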